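(* Let $k\ge 2$ be an even integer, $\ell\ge1$ an integer and $0<\epsilon<1$. The sample complexity of $(k,\epsilon)$-uniformity testing using $\mathcal{W}_\ell$ for private-coin protocols is $\Omega\!\left(\frac{k^{3/2}}{2^{\ell}\epsilon^2}\right)$, i.e., at least $c\,\frac{k^{3/2}}{2^{\ell}\epsilon^2}$ for a universal constant $c>0$.
   Context: Notation: $[k]=\{1,\dots,k\}$; $\Delta_k$ is the set of probability distributions on $[k]$; $d_{TV}(\mathbf p,\mathbf q)=\frac12\sum_{x}|\mathbf p(x)-\mathbf q(x)|$; $\mathbf u$ is the uniform distribution on $[k]$. A channel $W$ from $[k]$ to a finite set $\mathcal Y$ is a stochastic matrix with entries $W(y\mid x)$. $\mathcal{W}_\ell$ is the family of all channels from $[k]$ to $\{0,1\}^\ell$. Distributed model: there are $n$ players; $X_1,\dots,X_n$ are i.i.d. from an unknown $\mathbf p\in\Delta_k$ and player $i$ holds $X_i$. Player $i$ selects a channel $W_i\in\mathcal W$ and sends to a referee the output $Y_i$ of $W_i$ on input $X_i$ (the randomness realizing channel outputs is independent across players and unseen by the referee). In a public-coin protocol, a random variable $U$ independent of $X^n$ is available to all players and the referee, each $W_i$ is a function of $U$, and the referee's output may depend on $(Y^n,U)$. In a private-coin protocol, $U_1,\dots,U_n$ are mutually independent and independent of $X^n$, $W_i$ is a function of $U_i$ only, and the referee sees only $Y^n$ (it knows the mappings $U_i\mapsto W_i$ but not the realizations). An $(n,\epsilon)$-test for identity to a reference $\mathbf q\in\Delta_k$ using $\mathcal W$ consists of such a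 protocol and a referee mapping $T$ with values in $\{0,1\}$ such that $\Pr[T=1]>11/12$ when $\mathbf p=\mathbf q$ and $\Pr[T=0]>11/12$ whenever $d_{TV}(\mathbf p,\mathbf q)>\epsilon$. $(k,\epsilon)$-uniformity testing is this problem with $\mathbf q=\mathbf u$; its sample complexity using $\mathcal W$ for private-coin protocols is the least $n$ for which such a test with a private-coin protocol exists.
   Formalization: Proved for ε bounded away from 1: for each ε₀<1 there is c>0, uniform in k, ℓ and 0<ε≤ε₀, with n≥1 players counted; a single c for all ε<1 is impossible, since for ε≥1−1/k no distribution is ε-far from uniform and one player suffices. *)

(* Defs.v *)
From HB Require Import structures.
From mathcomp Require Import all_boot all_order all_algebra.
From mathcomp Require Import all_classical all_reals all_analysis.

Set Implicit Arguments.
Unset Strict Implicit.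
Unset Printing Implicit Defensive.

Import Order.TTheory GRing.Theory Num.Theory.

Local Open Scope classical_set_scope.
Local Open Scope ring_scope.

Record dist (R : realType) (T : finType) := Dist {
  pmf :> T -> R ;
  pmf_ge0 : forall x, 0 <= pmf x ;
  pmf_sum1 : \sum_(x : T) pmf x = 1 }.

Definition dTV (R : realType) (T : finType) (p q : dist R T) : R :=
  2^-1 * \sum_(x : T) `|p x - q x|.

Lemma uniform_ge0 (R : realType) (k : nat) (x : 'I_k) : 0 <= (k%:R^-1 : R).
Proof. by rewrite invr_ge0 ler0n. Qed.

Lemma uniform_sum1 (R : realType) (k : nat) (k_gt0 : (0 < k)%N) :
  \sum_(x : 'I_k) (k%:R^-1 : R) = 1.
Proof.
by rewrite sumr_const card_ord -[X in X = _]mulr_natr mulVf// pnatr_eq0 -lt0n.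
Qed.

Definition uniform (R : realType) (k : nat) (k_gt0 : (0 < k)%N) : dist R 'I_k :=
  Dist (@uniform_ge0 R k) (uniform_sum1 R k_gt0).

(* For W : channel R X Y, the entry W(y | x) of the stochastic matrix is W x y. *)
Definition channel (R : realType) (X Y : finType) := X -> dist R Y.

Definition bit_channels (R : realType) (k l : nat)
  : set (channel R 'I_k (l.-tuple bool)) := setT.
Arguments bit_channels : clear implicits.

(* The product rule is required for every subfamily J of the random variables. *)
Definition mutually_independent (R : realType) (n : nat)
    (d : measure_display) (Omega : measurableType d) (P : probability Omega R)
    (e : 'I_n -> measure_display) (V : forall i, measurableType (e i))
    (U : forall i, Omega -> V i) : Prop :=
  forall (J : {set 'I_n}) (A : forall i, set (V i)),
    (forall i, measurable (A i)) ->
    P (\bigcap_(i in [set i | i \in J]) (U i @^-1` A i)) =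
    (\prod_(i in J) P (U i @^-1` A i))%E.

(* The seeds U_1, ..., U_n live on a common probability space and take values
   in arbitrary measurable spaces; player i uses the channel W_i(U_i). *)
Record private_coin_protocol (R : realType) (k : nat) (Y : finType)
    (F : set (channel R 'I_k Y)) (n : nat) := PrivateCoinProtocol {
  coin_display : measure_display ;
  coin_space : measurableType coin_display ;
  coin_prob : probability coin_space R ;
  seed_display : 'I_n -> measure_display ;
  seed_space : forall i, measurableType (seed_display i) ;
  seed : forall i, coin_space -> seed_space i ;
  seed_measurable : forall i, measurable_fun setT (seed i) ;
  seed_independent : mutually_independent coin_prob seed ;
  player_channel : forall i, seed_space i -> channel R 'I_k Y ;
  player_channel_in : forall i (u : seed_space i), F (player_channel u) ;
  player_channel_measurable : forall i x y,
    measurable_fun setT (fun u : seed_space i => player_channel u x y : R) }.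

(* Pr[T(Y^n) = b] when the inputs X_1, ..., X_n are i.i.d. from p and
   independent of the seeds: given the seeds, (X^n, Y^n) = (x, y) has
   probability \prod_i p(x_i) W_i(y_i | x_i).  The referee's decision depends
   on the messages y alone, not on the seeds. *)
Definition decision_prob (R : realType) (k : nat) (Y : finType)
    (F : set (channel R 'I_k Y)) (n : nat) (prot : private_coin_protocol F n)
    (T : {ffun 'I_n -> Y} -> bool) (p : dist R 'I_k) (b : bool) : \bar R :=
  expectation (coin_prob prot) (fun w =>
    \sum_(x : {ffun 'I_n -> 'I_k}) \sum_(y : {ffun 'I_n -> Y} | T y == b)
      \prod_(i < n) (p (x i) * player_channel (seed i w) (x i) (y i))).

Definition identity_test (R : realType) (k : nat) (Y : finType)
    (F : set (channel R 'I_k Y)) (n : nat) (q : dist R 'I_k) (eps : R)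
    (prot : private_coin_protocol F n) (T : {ffun 'I_n -> Y} -> bool) : Prop :=
  ((11 / 12)%:E < decision_prob prot T q true)%E /\
  (forall p : dist R 'I_k, eps < dTV p q ->
     ((11 / 12)%:E < decision_prob prot T p false)%E).

(* The least number n >= 1 of players for which a test exists; +oo if no
   number of players suffices. *)
Definition private_sample_complexity (R : realType) (k : nat) (Y : finType)
    (F : set (channel R 'I_k Y)) (q : dist R 'I_k) (eps : R) : \bar R :=
  ereal_inf [set (n%:R : R)%:E | n in [set n : nat | (0 < n)%N /\
    exists (prot : private_coin_protocol F n) (T : {ffun 'I_n -> Y} -> bool),
      identity_test q eps prot T]].

(* Main.v *)
Require Import Defs.
From HB Require Import structures.
From mathcomp Require Import all_boot all_order all_algebra.
From mathcomp Require Import all_classical all_reals all_analysis.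
From mathcomp Require Import measurable_realfun ring lra.
Import Order.TTheory GRing.Theory Num.Theory.
Local Open Scope ring_scope.
Set Implicit Arguments.
Unset Strict Implicit.
Unset Printing Implicit Defensive.

(** Independent signs on a fixed pairing would lose a factor sqrt k. The chi-square statistic is
    then governed by the Frobenius norm of a Gram matrix of score vectors, of which only the trace,
    of order n 2^l eps^2 / k, is controlled. If all players send one bit through the same channel,
    this matrix has rank at most one and the two numbers agree, so that n of order k / (2^l eps^2)
    is all that follows. Signs chosen against the channels spread the trace: a proxy v of order
    trace / k in every direction of a k-dimensional space replaces the Frobenius norm by sqrt k
    times v. The price is that the walk needs the largest norm and not the mean one, so the few
    elements with a long score vector keep their uniform mass. One round of pairing produces
    relative masses 0 and 2 and stops near distance 1/2; after r rounds the distance is about 1 -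
    2^-r, while the proxy grows only by a factor of order 4^r, a constant once [eps0] is fixed.
    Rounding in the pairings is harmless for large k only, hence the separate treatment of small
    k. *)

(* Once the private coins are averaged out, the messages are independent with
   fixed channels, so the hard instances may be adapted to these channels. The
   chi-square statistic of a mixture of perturbations (1 + f(x)) / k of the
   uniform distribution is governed by inner products of sums of f(x) h_x,
   where h_1, ..., h_k are score vectors with sum of squared norms at most
   n 2^l / k. The Gram-Schmidt walk turns signed sums of vectors of squared norm
   at most rho into subgaussian vectors of variance proxy O(rho), in every
   direction at once. Apply it to the differences of paired score vectors, with
   each sign choosing which element of the pair takes the mass of both; iterating
   on the winners gives a random distribution far from uniform, up to any
   distance below 1, whose score is subgaussian of proxy v = O(n 2^l / k^2)
   times the squared amplitude. Comparison with a Gaussian in dimension k bounds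
   the chi-square statistic by (1 - v^2)^(-k/2) - 1, so a test needs k v^2
   bounded below, i.e. n of order k^(3/2) / (2^l eps^2). *)

(** * Two-point variables *)

Section TwoPoint.
Variable R : realType.
Implicit Types x b r m : R.

(* Moment generating function at [b] of [Y - x], where [Y] is the
   [{-1, 1}]-valued variable of mean [x]. *)
Definition two_point_mgf x b : R :=
  (1 + x) / 2 * expR (b * (1 - x)) + (1 - x) / 2 * expR (- (b * (1 + x))).

Lemma two_point_mgfE x b : two_point_mgf x b =
  ((1 + x) / 2 * expR b + (1 - x) / 2 * expR (- b)) * expR (- (b * x)).
Proof.
rewrite /two_point_mgf [RHS]mulrDl -!mulrA -!expRD.
by do 2![congr (_ + _) || congr (_ * (_ * expR _))]; ring.
Qed.

Lemma expR_le_quadratic r : `|r| <= 1 / 2 -> expR r <= 1 + r + 2 * r ^+ 2.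
Proof.
rewrite ler_norml => /andP[h1 h2].
have e1 := expR_ge1Dx (- r).
have e0 := expR_gt0 r.
have e : expR r * expR (- r) = 1 by rewrite -expRD subrr expR0.
have h : expR r * (1 - r) <= expR r * expR (- r) by rewrite ler_pM2l.
rewrite e in h.
have r1 : 0 < 1 - r by lra.
rewrite -(ler_pM2r r1); apply: (le_trans h).
have : 0 <= r ^+ 2 * (1 - 2 * r) by rewrite mulr_ge0 ?sqr_ge0//; lra.
by move=> ?; nra.
Qed.

(** The constant 4 is not sharp but needs no calculus: the quadratic bound on [expR] settles |r| <=
    1/2, and beyond that 4 r^2 >= 2 |r| absorbs both [expR |r|] and the sign of [m * r]. *)
Lemma two_point_hoeffding m r : -1 <= m -> m <= 1 ->
  (1 + m) / 2 * expR r + (1 - m) / 2 * expR (- r) <= expR (m * r + 4 * r ^+ 2).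
Proof.
move=> m1 m2; have [r1|r1] := leP `|r| (1 / 2).
  have h1 := expR_le_quadratic r1.
  have h2 : expR (- r) <= 1 - r + 2 * r ^+ 2.
    by have := @expR_le_quadratic (- r); rewrite normrN sqrrN; apply.
  have h3 : 1 + (m * r + 4 * r ^+ 2) <= expR (m * r + 4 * r ^+ 2).
    exact: expR_ge1Dx.
  apply: le_trans h3.
  have a1 : (1 + m) / 2 * expR r <= (1 + m) / 2 * (1 + r + 2 * r ^+ 2).
    by rewrite ler_wpM2l//; lra.
  have a2 : (1 - m) / 2 * expR (- r) <= (1 - m) / 2 * (1 - r + 2 * r ^+ 2).
    by rewrite ler_wpM2l//; lra.
  have := sqr_ge0 r; nra.
have h1 : expR r <= expR `|r| by rewrite ler_expR ler_norm.
have h2 : expR (- r) <= expR `|r| by rewrite ler_expR -normrN ler_norm.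
have h3 : expR `|r| <= expR (m * r + 4 * r ^+ 2).
  rewrite ler_expR -[r ^+ 2]real_normK ?num_real//.
  have : - `|r| <= m * r.
    have : `|m * r| <= `|r|.
      by rewrite normrM ler_piMl// ler_norml m1.
    by rewrite ler_norml => /andP[].
  by nra.
apply: le_trans h3.
have a1 : (1 + m) / 2 * expR r <= (1 + m) / 2 * expR `|r|.
  by rewrite ler_wpM2l//; lra.
have a2 : (1 - m) / 2 * expR (- r) <= (1 - m) / 2 * expR `|r|.
  by rewrite ler_wpM2l//; lra.
lra.
Qed.

Lemma two_point_mgf_le x b : -1 <= x -> x <= 1 ->
  two_point_mgf x b <= expR (4 * b ^+ 2).
Proof.
move=> x1 x2; rewrite two_point_mgfE.
have -> : expR (4 * b ^+ 2) = expR (x * b + 4 * b ^+ 2) * expR (- (b * x)).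
  by rewrite -expRD; congr expR; ring.
by rewrite ler_pM2r ?expR_gt0//; exact: two_point_hoeffding.
Qed.

Lemma two_point_mgf1 b : two_point_mgf 1 b = 1.
Proof. by rewrite /two_point_mgf subrr mulr0 expR0 !mul0r divff// mulr1 addr0. Qed.

Lemma two_point_mgfN1 b : two_point_mgf (-1) b = 1.
Proof.
rewrite /two_point_mgf subrr mulr0 oppr0 expR0 !mul0r add0r opprK -[1 + 1]/2%R.
by rewrite divff// mulr1.
Qed.

(** Reweighting the law of Y by exp(b Y) gives another two-point law, of mean m, and the Hoeffding
    bound for that law yields c = m - x. The tilt moves the mean in the direction of b, by at most 8
    |b|. *)
Lemma two_point_mgf_tilt x b : -1 <= x -> x <= 1 ->
  exists2 c : R, [/\ 0 <= b -> 0 <= c <= 8 * b & b <= 0 -> 8 * b <= c <= 0] &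
    forall r, two_point_mgf x (b + r) <=
              two_point_mgf x b * expR (c * r + 4 * r ^+ 2).
Proof.
move=> x1 x2.
set F := (1 + x) / 2 * expR b + (1 - x) / 2 * expR (- b).
have E1 := expR_gt0 b; have E2 := expR_gt0 (- b).
have F0 : 0 < F.
  rewrite /F; have [x0|x0] := leP 0 x.
    apply: ltr_pwDl; first by rewrite mulr_gt0//; lra.
    by rewrite mulr_ge0 ?expR_ge0//; lra.
  apply: ltr_wpDl; first by rewrite mulr_ge0 ?expR_ge0//; lra.
  by rewrite mulr_gt0//; lra.
have EE : expR b * expR (- b) = 1 by rewrite -expRD subrr expR0.
set m := ((1 + x) / 2 * expR b - (1 - x) / 2 * expR (- b)) / F.
have Fm : F * m = (1 + x) / 2 * expR b - (1 - x) / 2 * expR (- b).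
  by rewrite /m mulrC divfK// gt_eqF.
have mx : F * (m - x) = (1 - x) * (1 + x) / 2 * (expR b - expR (- b)).
  by rewrite mulrBr Fm /F; field.
have xE1 : 0 <= (1 + x) * expR b by rewrite mulr_ge0 ?expR_ge0//; lra.
have xE2 : 0 <= (1 - x) * expR (- b) by rewrite mulr_ge0 ?expR_ge0//; lra.
have m1 : -1 <= m by rewrite -(ler_pM2l F0) Fm /F; lra.
have m2 : m <= 1 by rewrite -(ler_pM2l F0) Fm /F; lra.
have xx : 0 <= (1 - x) * (1 + x) by rewrite mulr_ge0//; lra.
exists (m - x).
  split=> b0.
    have le12 : expR (- b) <= expR b by rewrite ler_expR; lra.
    have d : expR b - expR (- b) <= 2 * b * expR b.
      have : (1 + - (2 * b)) * expR b <= expR (- (2 * b)) * expR b.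
        by rewrite ler_pM2r// expR_ge1Dx.
      by rewrite -expRD (_ : - (2 * b) + b = - b); [lra|ring].
    apply/andP; split.
      by rewrite -(ler_pM2l F0) mx mulr0 mulr_ge0// ?divr_ge0// subr_ge0.
    rewrite -(ler_pM2l F0) mx.
    apply: (@le_trans _ _ ((1 - x) * (1 + x) / 2 * (2 * b * expR b))).
      by rewrite ler_wpM2l// divr_ge0.
    apply: (@le_trans _ _ (2 * b * ((1 + x) * expR b))).
      have : 0 <= b * ((1 + x) * expR b) by rewrite mulr_ge0.
      by nra.
    have := mulr_ge0 b0 xE1; have := mulr_ge0 b0 xE2; rewrite /F; lra.
  have le12 : expR b <= expR (- b) by rewrite ler_expR; lra.
  have d : expR (- b) - expR b <= - (2 * b) * expR (- b).
    have : (1 + 2 * b) * expR (- b) <= expR (2 * b) * expR (- b).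
      by rewrite ler_pM2r// expR_ge1Dx.
    by rewrite -expRD (_ : 2 * b + - b = b); [lra|ring].
  have nb : 0 <= - b by lra.
  apply/andP; split; last first.
    rewrite -(ler_pM2l F0) mx mulr0 mulr_ge0_le0 ?divr_ge0//; lra.
  rewrite -(ler_pM2l F0) mx.
  suff : (1 - x) * (1 + x) / 2 * (expR (- b) - expR b) <= F * (8 * - b) by lra.
  apply: (@le_trans _ _ ((1 - x) * (1 + x) / 2 * (- (2 * b) * expR (- b)))).
    by rewrite ler_wpM2l// divr_ge0.
  apply: (@le_trans _ _ (2 * - b * ((1 - x) * expR (- b)))).
    have : 0 <= - b * ((1 - x) * expR (- b)) by rewrite mulr_ge0.
    by nra.
  have := mulr_ge0 nb xE1; have := mulr_ge0 nb xE2; rewrite /F; lra.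
move=> r; rewrite !two_point_mgfE -/F.
have -> : (1 + x) / 2 * expR (b + r) + (1 - x) / 2 * expR (- (b + r)) =
    F * ((1 + m) / 2 * expR r + (1 - m) / 2 * expR (- r)).
  rewrite (_ : F * _ = (F + F * m) / 2 * expR r + (F - F * m) / 2 * expR (- r)).
    by rewrite Fm /F opprD !expRD; field.
  by field.
rewrite -[X in X <= _]mulrA -[X in _ <= X]mulrA ler_pM2l//.
apply: le_trans (_ : expR (m * r + 4 * r ^+ 2) * expR (- ((b + r) * x)) <= _).
  by rewrite ler_pM2r ?expR_gt0// two_point_hoeffding.
by rewrite -!expRD ler_expR; lra.
Qed.

End TwoPoint.

(** * Inner products and orthogonal projections *)

Section Dot.
Variable R : realType.

Definition dot d (u v : 'rV[R]_d) : R := \sum_i u 0 i * v 0 i.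

Lemma dotE d (u v : 'rV[R]_d) : dot u v = (u *m v^T) 0 0.
Proof. by rewrite mxE; apply: eq_bigr => i _; rewrite mxE. Qed.

Lemma dotC d (u v : 'rV[R]_d) : dot u v = dot v u.
Proof. by apply: eq_bigr => i _; rewrite mulrC. Qed.

Lemma dotDl d (u v w : 'rV[R]_d) : dot (u + v) w = dot u w + dot v w.
Proof. by rewrite -big_split; apply: eq_bigr => i _; rewrite mxE mulrDl. Qed.

Lemma dotZl d a (u v : 'rV[R]_d) : dot (a *: u) v = a * dot u v.
Proof. by rewrite mulr_sumr; apply: eq_bigr => i _; rewrite mxE mulrA. Qed.

Lemma dotNl d (u v : 'rV[R]_d) : dot (- u) v = - dot u v.
Proof. by rewrite -scaleN1r dotZl mulN1r. Qed.

Lemma dotBl d (u v w : 'rV[R]_d) : dot (u - v) w = dot u w - dot v w.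
Proof. by rewrite dotDl dotNl. Qed.

Lemma dotDr d (u v w : 'rV[R]_d) : dot w (u + v) = dot w u + dot w v.
Proof. by rewrite !(dotC w) dotDl. Qed.

Lemma dotZr d a (u v : 'rV[R]_d) : dot v (a *: u) = a * dot v u.
Proof. by rewrite !(dotC v) dotZl. Qed.

Lemma dotBr d (u v w : 'rV[R]_d) : dot w (u - v) = dot w u - dot w v.
Proof. by rewrite !(dotC w) dotBl. Qed.

Lemma dot0l d (v : 'rV[R]_d) : dot 0 v = 0.
Proof. by rewrite -(scale0r 0) dotZl mul0r. Qed.

Lemma dot_mulmxl d m (u : 'rV[R]_d) (M : 'M[R]_(d, m)) (v : 'rV_m) :
  dot (u *m M) v = dot u (v *m M^T).
Proof. by rewrite !dotE trmx_mul trmxK mulmxA. Qed.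

Lemma dot_ge0 d (u : 'rV[R]_d) : 0 <= dot u u.
Proof. by apply: sumr_ge0 => i _; rewrite -expr2 sqr_ge0. Qed.

Lemma dot_eq0 d (u : 'rV[R]_d) : dot u u = 0 -> u = 0.
Proof.
move/eqP; rewrite psumr_eq0 => [/allP h|i _]; last by rewrite -expr2 sqr_ge0.
apply/rowP => i; rewrite mxE; apply/eqP.
by have := h i (mem_index_enum _); rewrite mulf_eq0 orbb.
Qed.

Lemma cauchy_schwarz d (u v : 'rV[R]_d) : dot u v ^+ 2 <= dot u u * dot v v.
Proof.
have [v0|v0] := eqVneq (dot v v) 0.
  by rewrite (dot_eq0 v0) dotC dot0l expr0n /= dot0l mulr0.
have vp : 0 < dot v v by rewrite lt0r v0 dot_ge0.
have := dot_ge0 (dot v v *: u - dot u v *: v).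
rewrite !(dotBl, dotBr, dotZl, dotZr) (dotC v u) => h.
rewrite -subr_ge0 -(pmulr_rge0 _ vp); apply: le_trans h _.
by rewrite le_eqVlt; apply/orP; left; apply/eqP; ring.
Qed.

End Dot.

Section Projection.
Variable R : realType.

(** Orthogonal projection onto the row space, acting on the right. Passing to a basis of the rows
    keeps the Gram matrix invertible for dependent rows too. *)
Definition rowproj m d (W : 'M[R]_(m, d)) : 'M[R]_d :=
  (row_base W)^T *m invmx (row_base W *m (row_base W)^T) *m row_base W.

Lemma gram_unitmx m d (B : 'M[R]_(m, d)) : row_free B -> B *m B^T \in unitmx.
Proof.
move=> Bfree; rewrite -row_free_unit -kermx_eq0; apply/eqP/row_matrixP => i.
rewrite row0; set u := row i _.
have u0 : u *m (B *m B^T) = 0.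
  by rewrite /u -row_mul mulmx_ker row0.
suff uB : u *m B = 0 by apply: (row_free_inj Bfree); rewrite uB mul0mx.
by apply: dot_eq0; rewrite dotE trmx_mul !mulmxA -(mulmxA u) u0 mul0mx mxE.
Qed.

Lemma rowproj_tr m d (W : 'M[R]_(m, d)) : (rowproj W)^T = rowproj W.
Proof.
rewrite /rowproj; move: (row_base W) => B.
by rewrite !trmx_mul trmxK trmx_inv trmx_mul trmxK mulmxA.
Qed.

Lemma rowproj_sub m d (W : 'M[R]_(m, d)) : (rowproj W <= W)%MS.
Proof. by rewrite (submx_trans (submxMl _ _))// eq_row_base. Qed.

Lemma rowproj_id m m' d (W : 'M[R]_(m, d)) (V : 'M[R]_(m', d)) :
  (V <= W)%MS -> V *m rowproj W = V.
Proof.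
rewrite -(eq_row_base W) => /submxP[D ->]; rewrite /rowproj.
have := gram_unitmx (row_base_free W); move: (row_base W) D => B D BB.
by rewrite !mulmxA -(mulmxA D) mulmxK.
Qed.

Definition projsq m d (W : 'M[R]_(m, d)) (t : 'rV[R]_d) : R :=
  dot (t *m rowproj W) (t *m rowproj W).

Lemma projsqE m d (W : 'M[R]_(m, d)) (t : 'rV[R]_d) :
  projsq W t = dot t (t *m rowproj W).
Proof.
by rewrite /projsq dot_mulmxl rowproj_tr -mulmxA rowproj_id ?rowproj_sub.
Qed.

Lemma projsq_ge0 m d (W : 'M[R]_(m, d)) t : 0 <= projsq W t.
Proof. exact: dot_ge0. Qed.

Lemma projsq_le m d (W : 'M[R]_(m, d)) t : projsq W t <= dot t t.
Proof.
have := dot_ge0 (t - t *m rowproj W).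
rewrite dotBl !dotBr (dotC _ t) -projsqE -/(projsq W t); lra.
Qed.

Lemma projsqB m m' d (V : 'M[R]_(m', d)) (W : 'M[R]_(m, d)) (t : 'rV_d) :
  (V <= W)%MS ->
  let D := t *m rowproj W - t *m rowproj V in
  projsq W t - projsq V t = dot D D.
Proof.
move=> VW D.
have VWt : dot (t *m rowproj W) (t *m rowproj V) = projsq V t.
  rewrite projsqE dot_mulmxl rowproj_tr -mulmxA rowproj_id//.
  exact: submx_trans (rowproj_sub _) VW.
by rewrite /D dotBl !dotBr (dotC (t *m rowproj V)) VWt /projsq; ring.
Qed.

Lemma projsq_submx m m' d (V : 'M[R]_(m', d)) (W : 'M[R]_(m, d)) t :
  (V <= W)%MS -> projsq V t <= projsq W t.
Proof. by move=> VW; rewrite -subr_ge0 projsqB// dot_ge0. Qed.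

(** Since [v] lies in W and is orthogonal to V, it sees only the part of [t] in W orthogonal to V,
    whose squared norm is the difference of the two [projsq]; then Cauchy-Schwarz. *)
Lemma projsq_mono m m' d (V : 'M[R]_(m', d)) (W : 'M[R]_(m, d)) (v t : 'rV_d) :
  (V <= W)%MS -> (v <= W)%MS -> v *m rowproj V = 0 ->
  dot v t ^+ 2 <= dot v v * (projsq W t - projsq V t).
Proof.
move=> VW vW vV; rewrite projsqB//; set D := _ - _.
suff -> : dot v t = dot v D by exact: cauchy_schwarz.
have vE : v *m (rowproj W - rowproj V) = v by rewrite mulmxBr rowproj_id// vV subr0.
by rewrite -{1}vE dot_mulmxl linearB /= !rowproj_tr mulmxBr.
Qed.

End Projection.

(** * The Gram-Schmidt walk *)

Section FiniteLaw.
Variable R : realType.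

(* A finitely supported probability law on [T] is a list of weighted points. *)
Definition expect (T : Type) (mu : seq (R * T)) (g : T -> R) : R :=
  \sum_(a <- mu) a.1 * g a.2.

Definition is_law (T : eqType) (P : T -> Prop) (mu : seq (R * T)) : Prop :=
  (forall a, a \in mu -> 0 <= a.1 /\ P a.2) /\ \sum_(a <- mu) a.1 = 1.

Definition law_bind (T U : Type) (mu : seq (R * T)) (nu : T -> seq (R * U)) :=
  flatten [seq [seq (a.1 * b.1, b.2) | b <- nu a.2] | a <- mu].

Lemma expect_bind (T U : Type) (mu : seq (R * T)) (nu : T -> seq (R * U)) g :
  expect (law_bind mu nu) g = expect mu (fun t => expect (nu t) g).
Proof.
rewrite /expect /law_bind big_flatten big_map; apply: eq_bigr => a _.
by rewrite big_map mulr_sumr; apply: eq_bigr => b _; rewrite mulrA.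
Qed.

Lemma expect_cst (T : eqType) (P : T -> Prop) (mu : seq (R * T)) c :
  is_law P mu -> expect mu (fun=> c) = c.
Proof. by move=> [_ mu1]; rewrite /expect -mulr_suml mu1 mul1r. Qed.

Lemma is_law_bind (T U : eqType) (P : T -> Prop) (Q : U -> Prop)
    (mu : seq (R * T)) (nu : T -> seq (R * U)) :
  is_law P mu -> (forall t, P t -> is_law Q (nu t)) -> is_law Q (law_bind mu nu).
Proof.
move=> muP nuQ; split=> [c|].
  move=> /flatten_mapP[a amu /mapP[b bnu ->]] /=.
  have [a0 Pa] := muP.1 a amu; have [b0 Qb] := (nuQ _ Pa).1 b bnu.
  by split=> //; rewrite mulr_ge0.
rewrite /law_bind big_flatten big_map -muP.2 big_seq [RHS]big_seq.
apply: eq_bigr => a amu; rewrite big_map -mulr_sumr.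
by rewrite (nuQ _ (muP.1 a amu).2).2 mulr1.
Qed.

Lemma is_law_pt (T : eqType) (P : T -> Prop) t : P t -> is_law P [:: (1, t)].
Proof. by move=> Pt; split=> [a|]; rewrite ?big_seq1// inE => /eqP ->. Qed.

Lemma expect_pt (T : Type) (t : T) g : expect [:: (1, t)] g = g t.
Proof. by rewrite /expect big_seq1 mul1r. Qed.

Lemma expect_le (T : eqType) (P : T -> Prop) (mu : seq (R * T)) f g :
  is_law P mu -> (forall t, P t -> f t <= g t) -> expect mu f <= expect mu g.
Proof.
move=> [muP _] fg; rewrite /expect big_seq [leRHS]big_seq.
by apply: ler_sum => a /muP[a0 /fg h]; rewrite ler_wpM2l.
Qed.

Lemma eq_expect (T : Type) (mu : seq (R * T)) f g : f =1 g ->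
  expect mu f = expect mu g.
Proof. by move=> fg; apply: eq_bigr => a _; rewrite fg. Qed.

Lemma expectZ (T : Type) (mu : seq (R * T)) c f :
  expect mu (fun t => c * f t) = c * expect mu f.
Proof. by rewrite /expect mulr_sumr; apply: eq_bigr => a _; rewrite mulrCA. Qed.

Lemma expect_sum (T : Type) (mu : seq (R * T)) (I : Type) (r : seq I) (Q : pred I) f :
  expect mu (fun t => \sum_(i <- r | Q i) f i t) =
  \sum_(i <- r | Q i) expect mu (f i).
Proof. by rewrite exchange_big; apply: eq_bigr => a _; rewrite mulr_sumr. Qed.

Definition law_mix (T : Type) c (mu nu : seq (R * T)) :=
  law_bind [:: (c, true); (1 - c, false)] (fun b => if b then mu else nu).

Lemma is_law_mix (T : eqType) (P : T -> Prop) c (mu nu : seq (R * T)) :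
  0 <= c -> c <= 1 -> is_law P mu -> is_law P nu -> is_law P (law_mix c mu nu).
Proof.
move=> c0 c1 muP nuP; apply: (@is_law_bind _ _ (fun=> True)); last by case.
split=> [a|]; last by rewrite big_cons big_seq1 /= addrC subrK.
by rewrite !inE => /orP[] /eqP -> /=; split=> //; rewrite subr_ge0.
Qed.

Lemma expect_mix (T : Type) c (mu nu : seq (R * T)) g :
  expect (law_mix c mu nu) g = c * expect mu g + (1 - c) * expect nu g.
Proof. by rewrite expect_bind {1}/expect big_cons big_seq1. Qed.

End FiniteLaw.

Section GramSchmidtWalk.
Variables (R : realType) (N d : nat) (w : 'M[R]_(N, d)).
Implicit Types (A B : {set 'I_N}) (p : 'I_N) (x u z : 'rV[R]_N) (t : 'rV[R]_d).

(** Rows outside [A] are zeroed and not deleted, so that the type does not change as [A] shrinks. *)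
Definition rowsel A : 'M[R]_(N, d) :=
  \matrix_i (if i \in A then row i w else 0).

Lemma row_rowsel A i : row i (rowsel A) = if i \in A then row i w else 0.
Proof. by rewrite rowK. Qed.

Lemma row_sub_rowsel A i : i \in A -> (row i w <= rowsel A)%MS.
Proof. by move=> iA; rewrite (_ : row i w = row i (rowsel A)) ?row_sub// row_rowsel iA. Qed.

Lemma rowselS A B : A \subset B -> (rowsel A <= rowsel B)%MS.
Proof.
move=> /fintype.subsetP AB; apply/row_subP => i; rewrite row_rowsel.
by case: ifP => [/AB iB|_]; rewrite ?sub0mx ?row_sub_rowsel.
Qed.

Lemma rowproj_orth A (v : 'rV[R]_d) :
  (forall i, i \in A -> dot v (row i w) = 0) -> v *m rowproj (rowsel A) = 0.
Proof.
move=> vA; have /submxP[D DE] := rowproj_sub (rowsel A).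
rewrite -rowproj_tr DE trmx_mul mulmxA (_ : v *m (rowsel A)^T = 0) ?mul0mx//.
apply/rowP => i; rewrite !mxE; case iA: (i \in A); last first.
  by apply: big1 => j _; rewrite !mxE iA mxE mulr0.
by rewrite -[RHS](vA i)//; apply: eq_bigr => j _; rewrite !mxE iA !mxE.
Qed.

(** The Gram-Schmidt direction: the shortest displacement of the signed sum when the pivot moves at
    unit speed and the other alive coordinates move freely. *)
Definition residue A p : 'rV[R]_d :=
  row p w - row p w *m rowproj (rowsel (A :\ p)).

Lemma residue_proj A p : residue A p *m rowproj (rowsel (A :\ p)) = 0.
Proof. by rewrite mulmxBl -mulmxA (rowproj_id (rowproj_sub _)) subrr. Qed.

Lemma residue_orth A p (v : 'rV[R]_d) :
  (v <= rowsel (A :\ p))%MS -> dot (residue A p) v = 0.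
Proof.
by move=> vA; rewrite -(rowproj_id vA) -{1}rowproj_tr -dot_mulmxl residue_proj dot0l.
Qed.

Lemma residue_norm A p : dot (residue A p) (residue A p) <= dot (row p w) (row p w).
Proof.
rewrite /residue dotBl !dotBr (dotC _ (row p w)) -projsqE.
have := projsq_ge0 (rowsel (A :\ p)) (row p w); rewrite -/(projsq _ _); lra.
Qed.

Lemma residue_sub A p : p \in A -> (residue A p <= rowsel A)%MS.
Proof.
move=> pA; rewrite addmx_sub ?row_sub_rowsel// eqmx_opp.
apply: submx_trans (submxMl _ _) (submx_trans (rowproj_sub _) _).
exact/rowselS/subD1set.
Qed.

Lemma residue_comb A p : p \in A -> exists u : 'rV[R]_N,
  [/\ forall j, j \notin A -> u 0 j = 0, u 0 p = 1 & u *m w = residue A p].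
Proof.
move=> pA; have /submxP[D DE] : (row p w *m rowproj (rowsel (A :\ p)) <= rowsel (A :\ p))%MS.
  exact: submx_trans (submxMl _ _) (rowproj_sub _).
exists (\row_j ((j == p)%:R - D 0 j *+ (j \in A :\ p))); split.
- move=> j jA; rewrite mxE !inE (negbTE jA) andbF subr0.
  by case: eqP jA => // ->; rewrite pA.
- by rewrite mxE !inE eqxx subr0.
rewrite /residue DE; apply/rowP => i; rewrite !mxE.
under eq_bigr do rewrite mxE mulrBl.
rewrite sumrB; congr (_ - _).
  rewrite (bigD1 p)//= eqxx mul1r big1 ?addr0// => j /negbTE ->.
  by rewrite mul0r.
apply: eq_bigr => j _; rewrite !mxE; case: (j \in _); rewrite ?mxE//.
by rewrite mul0r mulr0.
Qed.

(* A potential for alive coordinates [A] and pivot [p]: a mean-zero step along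
   the residue preserves it in expectation, as [two_point_mgf x b * expR (b * x)]
   is affine in [x], and freezing a coordinate does not increase it. *)
Definition walk_bound rho A p x t : R :=
  expR (4 * (rho * projsq (rowsel A) t - dot (residue A p) t ^+ 2)) *
  two_point_mgf (x 0 p) (dot (residue A p) t).

(** When the pivot is frozen, the drop in [projsq] pays for the negative square that disappears from
    [walk_bound]. *)
Lemma residue_gain rho A p t : p \in A -> dot (row p w) (row p w) <= rho ->
  dot (residue A p) t ^+ 2 <=
  rho * (projsq (rowsel A) t - projsq (rowsel (A :\ p)) t).
Proof.
move=> pA wp; have AA : (rowsel (A :\ p) <= rowsel A)%MS by rewrite rowselS// subD1set.
apply: le_trans (projsq_mono t AA (residue_sub pA) (residue_proj A p)) _.
by rewrite ler_wpM2r ?subr_ge0 ?projsq_submx// (le_trans (residue_norm _ _)).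
Qed.

(* Freezing a coordinate other than the pivot turns the residue [b] into
   [b + q] with [q] orthogonal to [b]; the combination [|q|^2 b - |b|^2 q] is
   orthogonal to the new span and witnesses the loss in [projsq]. *)
Lemma residue_shift rho A p j t : p \in A -> j \in A -> j != p ->
  dot (row p w) (row p w) <= rho ->
  - (4 * dot (residue A p) t *
     (dot (residue (A :\ j) p) t - dot (residue A p) t)) <=
  rho * (projsq (rowsel A) t - projsq (rowsel (A :\ j)) t).
Proof.
move=> pA jA jp wp.
set b := residue A p; set b1 := residue (A :\ j) p; set q := b1 - b.
have pA1 : p \in A :\ j by rewrite !inE eq_sym jp.
have AA1 : (rowsel (A :\ j) <= rowsel A)%MS by rewrite rowselS// subD1set.
have AA1p : (rowsel (A :\ j :\ p) <= rowsel (A :\ p))%MS.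
  by rewrite rowselS// finset.setSD// subD1set.
have qE : q = row p w *m rowproj (rowsel (A :\ p)) -
              row p w *m rowproj (rowsel (A :\ j :\ p)).
  by rewrite /q /b1 /b /residue opprB [LHS]addrC addrA subrK.
have q_sub : (q <= rowsel (A :\ p))%MS.
  rewrite qE addmx_sub// ?eqmx_opp; last apply: submx_trans AA1p.
    exact: submx_trans (submxMl _ _) (rowproj_sub _).
  exact: submx_trans (submxMl _ _) (rowproj_sub _).
have b_orth v : (v <= rowsel (A :\ p))%MS -> dot b v = 0 by exact: residue_orth.
have b1_orth v : (v <= rowsel (A :\ j :\ p))%MS -> dot b1 v = 0.
  exact: residue_orth.
have b_sub : (b <= rowsel A)%MS by exact: residue_sub.
have wpE : row p w = b1 + row p w *m rowproj (rowsel (A :\ j :\ p)).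
  by rewrite /b1 /residue subrK.
have b1_norm : dot b1 b1 <= dot (row p w) (row p w) by exact: residue_norm.
have b_q := b_orth _ q_sub.
have b1E : b1 = b + q by rewrite /q addrC subrK.
have qE' : q = b1 - b by [].
have -> : dot b1 t - dot b t = dot q t by rewrite -dotBl.
move: b_q b1E qE' b_sub wpE b1_norm b_orth b1_orth q_sub {qE}.
clearbody q; move: b1 b => b1 b b_q b1E qE b_sub wpE b1_norm b_orth b1_orth q_sub.
set B := dot b b; set Q := dot q q.
have B0 : 0 <= B := dot_ge0 b.
have Q0 : 0 <= Q := dot_ge0 q.
have BQ : B + Q <= rho.
  apply: le_trans wp; apply: le_trans b1_norm.
  by rewrite b1E dotDl !dotDr (dotC q b) b_q -/B -/Q addr0 add0r.
have NN : 0 <= projsq (rowsel A) t - projsq (rowsel (A :\ j)) t.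
  by rewrite subr_ge0 projsq_submx.
pose v := Q *: b - B *: q.
have v_sub : (v <= rowsel A)%MS.
  rewrite addmx_sub ?eqmx_opp ?scalemx_sub//.
  by rewrite (submx_trans q_sub)// rowselS// subD1set.
have v_orth1 (i : 'I_N) : i \in A :\ j :\ p -> dot v (row i w) = 0.
  move=> iA; have iA1 := row_sub_rowsel iA.
  have b10 : dot b1 (row i w) = 0 by exact: b1_orth.
  have b0 : dot b (row i w) = 0 by apply: b_orth; exact: submx_trans AA1p.
  by rewrite dotBl !dotZl qE dotBl b10 b0 subr0 !mulr0 subr0.
have v_proj1 : v *m rowproj (rowsel (A :\ j :\ p)) = 0 by exact: rowproj_orth.
have v_proj : v *m rowproj (rowsel (A :\ j)) = 0.
  apply: rowproj_orth => i iA; have [->|ip] := eqVneq i p; last first.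
    by apply: v_orth1; rewrite in_setD1 ip.
  rewrite wpE dotDr (dotC _ (_ *m _)) dot_mulmxl.
  rewrite rowproj_tr v_proj1 (dotC _ 0) dot0l addr0 b1E.
  rewrite dotBl !dotZl !dotDr (dotC q b) b_q -/B -/Q; ring.
have := projsq_mono t AA1 v_sub v_proj.
have -> : dot v v = Q * B * (B + Q).
  by rewrite dotBl !dotBr !dotZl !dotZr (dotC q b) b_q -/B -/Q; ring.
have -> : dot v t = Q * dot b t - B * dot q t by rewrite dotBl !dotZl.
set D := projsq _ _ - _ in NN *; move=> key.
have [Q00|Qn] := eqVneq Q 0.
  by rewrite (dot_eq0 Q00) dot0l mulr0 oppr0 mulr_ge0//; lra.
have [B00|Bn] := eqVneq B 0.
  by rewrite (dot_eq0 B00) dot0l mulr0 mul0r oppr0 mulr_ge0//; lra.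
have QB : 0 < Q * B by rewrite mulr_gt0// lt0r ?Qn ?Bn.
apply: (@le_trans _ _ ((B + Q) * D)); last by rewrite ler_wpM2r.
rewrite -(ler_pM2l QB) (mulrA (Q * B)); apply: le_trans key.
(* With X = [Q * dot b t] and Z = [B * dot q t], -4 X Z = (X - Z)^2 - (X + Z)^2 <= (X - Z)^2, which
   [key] bounds. *)
have := sqr_ge0 (Q * dot b t + B * dot q t); lra.
Qed.

(** Let the residue product change from b to b + r. The 4 r^2 of the tilting bound cancels against
    the square in the potential, leaving c r <= 4 rho (n - n1) + 8 b r. If b and r agree in sign,
    |c| <= 8 |b| is enough; otherwise c r <= 0 and [residue_shift] pays for 8 b r. *)
Lemma walk_bound_shift rho A p j x t : p \in A -> j \in A -> j != p ->
  dot (row p w) (row p w) <= rho -> -1 <= x 0 p -> x 0 p <= 1 ->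
  walk_bound rho (A :\ j) p x t <= walk_bound rho A p x t.
Proof.
move=> pA jA jp wp x1 x2; rewrite /walk_bound.
have key := residue_shift t pA jA jp wp.
have NN : 0 <= rho * (projsq (rowsel A) t - projsq (rowsel (A :\ j)) t).
  rewrite mulr_ge0 ?(le_trans (dot_ge0 _) wp)// subr_ge0 projsq_submx//.
  by rewrite rowselS// subD1set.
move: key NN; set b := dot (residue A p) t; set b1 := dot _ t.
set r := b1 - b; have -> : b1 = b + r by rewrite /r addrC subrK.
set n := projsq _ _; set n1 := projsq _ _ => key NN.
have [c [cp cn] h] := two_point_mgf_tilt b x1 x2.
apply: le_trans (ler_wpM2l (expR_ge0 _) (h r)) _.
rewrite mulrCA mulrC ler_wpM2r//.
  by rewrite two_point_mgfE mulr_ge0 ?expR_ge0// addr_ge0// mulr_ge0 ?expR_ge0//; lra.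
rewrite -expRD ler_expR.
suff : c * r <= 4 * (rho * (n - n1)) + 8 * (b * r) by lra.
have [b0|b0] := leP 0 b; have [r0|r0] := leP 0 r.
- by have /andP[_ /(ler_wpM2r r0)] := cp b0; lra.
- have /andP[c0 _] := cp b0.
  have : c * r <= 0 by rewrite mulr_ge0_le0// ltW.
  lra.
- have /andP[_ c0] := cn (ltW b0).
  have : c * r <= 0 by rewrite mulr_le0_ge0.
  lra.
- have /andP[c8 _] := cn (ltW b0).
  have : c * r <= 8 * b * r by rewrite ler_nM2r.
  lra.
Qed.

Definition is_signing z := forall j, z 0 j = 1 \/ z 0 j = -1.

Definition walk_law rho A p x := exists2 mu : seq (R * 'rV[R]_N),
  is_law is_signing mu &
  forall t, expect mu (fun z => expR (dot ((z - x) *m w) t)) <=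
            walk_bound rho A p x t.

(** An alive coordinate may already sit at 1 or -1: coordinates that hit the boundary together are
    removed one at a time. *)
Definition walk_state A x := forall j,
  if j \in A then is_true (-1 <= x 0 j <= 1) else x 0 j = 1 \/ x 0 j = -1.

(** If j is not the pivot, the pivot is kept. If it is, its generating function equals 1 and any
    alive p' may take over: the bound exp(4 b'^2) on its generating function cancels the -4 b'^2 in
    its potential, leaving exp(4 rho [projsq]) for the smaller set, which [residue_gain]
    controls. *)
Lemma walk_freeze rho A p j x : (forall i, dot (row i w) (row i w) <= rho) ->
  p \in A -> walk_state A x -> j \in A -> x 0 j = 1 \/ x 0 j = -1 ->
  (forall p', p' \in A :\ j -> walk_law rho (A :\ j) p' x) ->
  walk_law rho A p x.
Proof.
move=> wrho pA xA jA xj IH.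
have [x1 x2] : -1 <= x 0 p /\ x 0 p <= 1 by have := xA p; rewrite pA => /andP[].
have [jp|jp] := eqVneq j p; last first.
  have pA1 : p \in A :\ j by rewrite !inE eq_sym jp.
  have [mu muP mub] := IH _ pA1; exists mu; first exact: muP.
  move=> t; exact: le_trans (mub t) (walk_bound_shift t pA jA jp (wrho p) x1 x2).
rewrite {j}jp in jA xj IH *.
have gain t : 4 * (rho * projsq (rowsel (A :\ p)) t) <=
    4 * (rho * projsq (rowsel A) t - dot (residue A p) t ^+ 2).
  by have := residue_gain t pA (wrho p); lra.
have bound t : expR (4 * (rho * projsq (rowsel (A :\ p)) t)) <= walk_bound rho A p x t.
  rewrite /walk_bound; have -> : two_point_mgf (x 0 p) (dot (residue A p) t) = 1.
    by case: xj => ->; rewrite ?two_point_mgf1 ?two_point_mgfN1.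
  by rewrite mulr1 ler_expR.
have rho0 : 0 <= rho := le_trans (dot_ge0 _) (wrho p).
have [A0|[p' p'A]] := set_0Vmem (A :\ p).
  exists [:: (1, x)].
    apply: is_law_pt => i; have := xA i; case: ifP => // iA _.
    have [->//|ip] := eqVneq i p.
    by have := finset.in_set0 i; rewrite -A0 !inE ip iA.
  move=> t; rewrite expect_pt subrr mul0mx dot0l expR0.
  apply: le_trans (bound t); rewrite -expR0 ler_expR.
  by rewrite !mulr_ge0// projsq_ge0.
have [mu muP mub] := IH _ p'A; exists mu => // t.
apply: le_trans (mub t) (le_trans _ (bound t)); rewrite /walk_bound.
have [y1 y2] : -1 <= x 0 p' /\ x 0 p' <= 1.
  by have := xA p'; move: p'A; rewrite !inE => /andP[_ ->] /andP[].
apply: le_trans (ler_wpM2l (expR_ge0 _) (two_point_mgf_le _ y1 y2)) _.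
by rewrite -expRD ler_expR; lra.
Qed.

Lemma walk_boundary A p x u : p \in A -> u 0 p != 0 ->
  (forall j, j \in A -> -1 < x 0 j < 1) ->
  exists2 g : R, 0 < g & (forall j, j \in A -> -1 <= (x + g *: u) 0 j <= 1) /\
    exists2 j, j \in A & (x + g *: u) 0 j = 1 \/ (x + g *: u) 0 j = -1.
Proof.
(* [T j] is the time at which coordinate j, moving at speed [u 0 j], reaches the endpoint it is
   heading for; the witness is the first such time. *)
move=> pA up xA; pose T j := (1 - Num.sg (u 0 j) * x 0 j) / `|u 0 j|.
pose P i := (i \in A) && (u 0 i != 0).
have Pp : P p by rewrite /P pA.
case: (@arg_minP _ _ _ p P T Pp) => j /andP[jA uj] jmin.
have sgx i : i \in A -> `|Num.sg (u 0 i) * x 0 i| < 1.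
  move=> iA; rewrite normrM; apply: le_lt_trans (_ : `|x 0 i| < 1).
    by rewrite ler_piMl// normr_sg; case: (_ != 0).
  by rewrite ltr_norml xA.
have uE i : u 0 i = Num.sg (u 0 i) * `|u 0 i| by rewrite -numEsg.
have sg2 i : u 0 i != 0 -> Num.sg (u 0 i) * Num.sg (u 0 i) = 1.
  by move=> ui; rewrite -expr2 sqr_sg ui.
have xg i g : u 0 i != 0 ->
    (x + g *: u) 0 i = Num.sg (u 0 i) * (Num.sg (u 0 i) * x 0 i + g * `|u 0 i|).
  move=> ui; rewrite !mxE [in LHS]uE mulrDr !mulrA sg2// mul1r; congr (_ + _).
  by rewrite mulrAC mulrC mulrA.
have /andP[_ sgj] : -1 < Num.sg (u 0 j) * x 0 j < 1 by rewrite -ltr_norml sgx.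
exists (T j); first by rewrite divr_gt0 ?normr_gt0// subr_gt0.
have T0 : 0 <= T j.
  by rewrite divr_ge0// subr_ge0 ltW.
split; last first.
  exists j => //; rewrite xg// /T divfK ?normr_eq0// addrC subrK mulr1.
  by move: uj; rewrite neq_lt => /orP[/ltr0_sg|/gtr0_sg] ->; [right|left].
move=> i iA; have [ui|ui] := eqVneq (u 0 i) 0.
  by rewrite !mxE ui mulr0 addr0; have /andP[? ?] := xA i iA; rewrite !ltW.
rewrite -ler_norml xg// normrM normr_sg ui mul1r ler_norml.
have h1 : T j * `|u 0 i| <= 1 - Num.sg (u 0 i) * x 0 i.
  by rewrite -ler_pdivlMr ?normr_gt0// jmin// /P iA.
have h2 : 0 <= T j * `|u 0 i| by rewrite mulr_ge0.
have := sgx i iA; rewrite ltr_norml => /andP[? ?]; apply/andP; split; lra.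
Qed.

Lemma walk_lawP rho A p x : (forall i, dot (row i w) (row i w) <= rho) ->
  p \in A -> walk_state A x -> walk_law rho A p x.
Proof.
move=> wrho; move: {2}#|A| (leqnn #|A|) => n.
elim: n A p x => [|n IH] A p x.
  by rewrite leqn0 cards_eq0 => /eqP ->; rewrite inE.
move=> An pA xA.
have frozen y : walk_state A y ->
    (exists2 j, j \in A & y 0 j = 1 \/ y 0 j = -1) -> walk_law rho A p y.
  move=> yA [j jA yj]; apply: (walk_freeze wrho pA yA jA yj) => p' p'A.
  apply: IH => //.
    by move: An; rewrite (cardsD1 j) jA add1n ltnS.
  move=> i; have := yA i; rewrite !inE.
  by have [->|ij] := eqVneq i j; rewrite ?jA.
have [//|nofrozen] := pselect (exists2 j, j \in A & x 0 j = 1 \/ x 0 j = -1).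
  exact: frozen.
have xA' j : j \in A -> -1 < x 0 j < 1.
  move=> jA; have := xA j; rewrite jA => /andP[h1 h2].
  rewrite !lt_neqAle h1 h2 !andbT; apply/andP; split; apply/negP => /eqP h.
    by apply: nofrozen; exists j => //; right.
  by apply: nofrozen; exists j => //; left.
have [u [uA up uw]] := residue_comb pA.
have up0 : u 0 p != 0 by rewrite up oner_eq0.
have nup0 : (- u) 0 p != 0 by rewrite mxE oppr_eq0.
have [g1 g1p [st1 fr1]] := walk_boundary pA up0 xA'.
have [g2 g2p [st2 fr2]] := walk_boundary pA nup0 xA'.
have move_state (g : R) (v : 'rV[R]_N) : (forall j, j \notin A -> v 0 j = 0) ->
    (forall j, j \in A -> -1 <= (x + g *: v) 0 j <= 1) -> walk_state A (x + g *: v).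
  move=> vA h j; case: ifP => [jA|/negbT jA]; first exact: h.
  by rewrite !mxE vA// mulr0 addr0; have := xA j; rewrite (negbTE jA).
have nuA j : j \notin A -> (- u) 0 j = 0 by move=> jA; rewrite mxE uA// oppr0.
have [mu1 mu1P mu1b] := frozen _ (move_state _ _ uA st1) fr1.
have [mu2 mu2P mu2b] := frozen _ (move_state _ _ nuA st2) fr2.
have g12 : 0 < g1 + g2 by rewrite addr_gt0.
(* The weight of the step +g1 against -g2 that makes the step mean zero: c g1 = (1 - c) g2. *)
pose c := g2 / (g1 + g2).
have c0 : 0 <= c by rewrite divr_ge0 ?ltW.
have c1 : c <= 1 by rewrite ler_pdivrMr// mul1r lerDr ltW.
exists (law_mix c mu1 mu2); first exact: is_law_mix.
move=> t; rewrite expect_mix.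
set b := dot (residue A p) t.
(* The step moves the signed sum by g times the residue. The resulting factor exp(g b) cancels the
   one from the new pivot value in the potential, so only an expression affine in that value remains
   to be averaged. *)
have shift mu (y : 'rV[R]_N) (g : R) : y - x = g *: u ->
    expect mu (fun z => expR (dot ((z - x) *m w) t)) =
    expR (g * b) * expect mu (fun z => expR (dot ((z - y) *m w) t)).
  move=> yx; rewrite -expectZ; apply: eq_expect => z.
  rewrite -expRD; congr expR.
  have -> : z - x = (y - x) + (z - y) by rewrite [RHS]addrC addrA subrK.
  by rewrite mulmxDl dotDl yx -scalemxAl uw dotZl.
rewrite (@shift mu1 (x + g1 *: u) g1); last by rewrite addrC addKr.
rewrite (@shift mu2 (x + g2 *: - u) (- g2)); last first.
  by rewrite addrC addKr scalerN scaleNr.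
have e1 := ler_wpM2l c0 (ler_wpM2l (expR_ge0 (g1 * b)) (mu1b t)).
have c1' : 0 <= 1 - c by rewrite subr_ge0.
have e2 := ler_wpM2l c1' (ler_wpM2l (expR_ge0 (- g2 * b)) (mu2b t)).
apply: le_trans (lerD e1 e2) _.
rewrite /walk_bound -/b !two_point_mgfE.
have y1 : (x + g1 *: u) 0 p = x 0 p + g1 by rewrite !mxE up mulr1.
have y2 : (x + g2 *: - u) 0 p = x 0 p - g2 by rewrite !mxE up mulrN1.
rewrite y1 y2; set K := expR (4 * _).
have -> : expR (- (b * (x 0 p + g1))) = expR (- (b * x 0 p)) * expR (- (g1 * b)).
  by rewrite -expRD; congr expR; ring.
have -> : expR (- (b * (x 0 p - g2))) = expR (- (b * x 0 p)) * expR (- (- g2 * b)).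
  by rewrite -expRD; congr expR; ring.
have i1 : expR (g1 * b) * expR (- (g1 * b)) = 1 by rewrite -expRD subrr expR0.
have i2 : expR (- g2 * b) * expR (- (- g2 * b)) = 1 by rewrite -expRD subrr expR0.
rewrite le_eqVlt; apply/orP; left; apply/eqP.
set E := expR (- (b * _)); set F := expR b; set G := expR (- b).
transitivity (K * E * (c * ((1 + (x 0 p + g1)) / 2 * F + (1 - (x 0 p + g1)) / 2 * G)
    * (expR (g1 * b) * expR (- (g1 * b)))
  + (1 - c) * ((1 + (x 0 p - g2)) / 2 * F + (1 - (x 0 p - g2)) / 2 * G)
    * (expR (- g2 * b) * expR (- (- g2 * b))))); first by ring.
by rewrite i1 i2 /c; field; rewrite gt_eqF.
Qed.

(* By the Gram-Schmidt walk of Bansal, Dadush, Garg and Lovett. *)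
Lemma subgaussian_signing rho : 0 <= rho -> (forall i, dot (row i w) (row i w) <= rho) ->
  exists2 mu : seq (R * 'rV[R]_N), is_law is_signing mu &
  forall t, expect mu (fun z => expR (dot (z *m w) t)) <= expR (4 * rho * dot t t).
Proof.
move=> rho0 wrho; have [N0|[p pT]] := set_0Vmem [set: 'I_N].
  exists [:: (1, 0)].
    apply: is_law_pt => j.
    by have := finset.in_set0 j; rewrite -N0 inE.
  move=> t; rewrite expect_pt mul0mx dot0l -expR0 ler_expR.
  by rewrite !mulr_ge0// dot_ge0.
have [|mu muP mub] := @walk_lawP rho [set: 'I_N] p 0 wrho pT.
  by move=> j; rewrite !inE mxE lerN10 ler01.
exists mu => // t.
rewrite (_ : expect mu _ = expect mu (fun z => expR (dot ((z - 0) *m w) t)));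
  last first.
  by apply: eq_expect => z; rewrite subr0.
apply: le_trans (mub t) _; rewrite /walk_bound mxE.
have := two_point_mgf_le (dot (residue [set: 'I_N] p) t) (lerN10 R) ler01.
move=> /(ler_wpM2l (expR_ge0 _)) h; apply: le_trans (h _) _.
rewrite -expRD ler_expR.
have := ler_wpM2l rho0 (projsq_le (rowsel [set: 'I_N]) t); lra.
Qed.
End GramSchmidtWalk.

(** * Iterated halving *)

Section Halving.
Variables (R : realType) (k d : nat) (h : 'M[R]_(k, d)).
Implicit Types (S : {set 'I_k}) (f : 'rV[R]_k) (t : 'rV[R]_d).

Lemma set_pairing S : exists p q : 'I_(#|S|./2) -> 'I_k,
  [/\ injective p, injective q, (forall i j, p i != q j) &
      forall j, p j \in S /\ q j \in S].
Proof.
have lt1 (j : 'I_(#|S|./2)) : (j.*2.+1 < #|S|)%N.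
  have := ltn_ord j; rewrite -leq_double doubleS => lt_j; apply: leq_trans lt_j _.
  by rewrite -[leqRHS]odd_double_half leq_addl.
have lt0 (j : 'I_(#|S|./2)) : (j.*2 < #|S|)%N by rewrite ltnW.
exists (fun j => enum_val (Ordinal (lt0 j))), (fun j => enum_val (Ordinal (lt1 j))).
split=> [i j|i j|i j|j].
- by move=> /enum_val_inj[] /double_inj /val_inj.
- by move=> /enum_val_inj[] /double_inj /val_inj.
- apply/eqP => /enum_val_inj[] /(congr1 odd).
  by rewrite /= !odd_double.
by split; exact: enum_valP.
Qed.

(** Losers in r rounds of a knockout among s elements; an unpaired element keeps its value and
    leaves the game. *)
Fixpoint halving_zeros (r s : nat) : nat :=
  if r is r'.+1 then (s./2 + halving_zeros r' s./2)%N else 0%N.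

Definition halving_outcome r S f0 f :=
  [/\ forall x, x \notin S -> f 0 x = f0 0 x,
      forall x, x \in S -> 0 <= f 0 x,
      \sum_x f 0 x = \sum_x f0 0 x &
      (halving_zeros r #|S| <= #|[set x in S | (f 0 x == 0)%R]|)%N].

(** Survivors of i rounds carry 2^i a, so the vectors signed in the next round have squared norm at
    most 4 * 4^i a^2 [Hm]. Proxies add up over successive rounds, and [4 ^+ r.+1 - 4] dominates the
    geometric sum of the 4 * 4^i for i < r while vanishing at r = 0. *)
Lemma random_halving r : forall a Hm S f0, 0 <= a -> 0 <= Hm ->
  (forall x, x \in S -> f0 0 x = a) ->
  (forall x, x \in S -> dot (row x h) (row x h) <= Hm) ->
  exists2 mu : seq (R * 'rV[R]_k), is_law (halving_outcome r S f0) mu &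
  forall t, expect mu (fun f => expR (dot ((f - f0) *m h) t)) <=
    expR (4 * (a ^+ 2 * (4 ^+ r.+1 - 4) * Hm) * dot t t).
Proof.
elim: r => [|r IH] a Hm S f0 a0 Hm0 f0S hS.
  exists [:: (1, f0)].
    by apply: is_law_pt; split=> // x /f0S ->.
  by move=> t; rewrite expect_pt subrr mul0mx dot0l expr1 subrr mulr0 mul0r mulr0 mul0r.
have [p [q [p_inj q_inj pq pqS]]] := set_pairing S.
pose N := #|S|./2.
pose D : 'M[R]_(N, k) := \matrix_(j, x) (a * ((p j == x)%:R - (q j == x)%:R)).
have rowD j : row j (D *m h) = a *: (row (p j) h - row (q j) h).
  apply/rowP => i; rewrite !mxE.
  under eq_bigr => x _ do rewrite !mxE -mulrA mulrBl.
  rewrite -mulr_sumr sumrB; congr (_ * (_ - _)).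
    rewrite (bigD1 (p j))//= eqxx mul1r big1 ?addr0// => x.
    by rewrite eq_sym => /negbTE ->; rewrite mul0r.
  rewrite (bigD1 (q j))//= eqxx mul1r big1 ?addr0// => x.
  by rewrite eq_sym => /negbTE ->; rewrite mul0r.
have Dnorm j : dot (row j (D *m h)) (row j (D *m h)) <= 4 * a ^+ 2 * Hm.
  rewrite rowD dotZl dotZr mulrA -expr2.
  rewrite (_ : 4 * a ^+ 2 * Hm = a ^+ 2 * (4 * Hm)); last by ring.
  rewrite ler_wpM2l ?sqr_ge0//.
  have [pS qS] := pqS j.
  (* Parallelogram law: the squared norm of a difference is at most twice the sum of the squared
     norms. *)
  have := dot_ge0 (row (p j) h + row (q j) h).
  rewrite !dotBl !dotBr !dotDl !dotDr (dotC (row (q j) h)).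
  by have := hS _ pS; have := hS _ qS; lra.
have D0 : 0 <= 4 * a ^+ 2 * Hm by rewrite !mulr_ge0// sqr_ge0.
have [mu muP mub] := subgaussian_signing D0 Dnorm.
pose f1 (z : 'rV[R]_N) := f0 + z *m D.
have f1p z j : f1 z 0 (p j) = a + a * z 0 j.
  rewrite !mxE f0S; last by have [] := pqS j.
  congr (_ + _); rewrite (bigD1 j)//= big1 ?addr0 => [|i ij].
    by rewrite mxE eqxx eq_sym (negbTE (pq _ _)) subr0 mulr1 mulrC.
  by rewrite mxE (inj_eq p_inj) (negbTE ij) eq_sym (negbTE (pq _ _)) subr0 !mulr0.
have f1q z j : f1 z 0 (q j) = a - a * z 0 j.
  rewrite !mxE f0S; last by have [] := pqS j.
  congr (_ + _); rewrite (bigD1 j)//= big1 ?addr0 => [|i ij].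
    by rewrite mxE eqxx (negbTE (pq _ _)) sub0r mulrN1 mulrN mulrC.
  by rewrite mxE (inj_eq q_inj) (negbTE ij) (negbTE (pq _ _)) subr0 !mulr0.
have f1o z x : (forall j, p j != x) -> (forall j, q j != x) -> f1 z 0 x = f0 0 x.
  move=> px qx; rewrite !mxE big1 ?addr0// => j _.
  by rewrite mxE (negbTE (px j)) (negbTE (qx j)) subr0 !mulr0.
have f1sum z : \sum_x f1 z 0 x = \sum_x f0 0 x.
  under eq_bigr do rewrite !mxE.
  rewrite big_split /= [X in _ + X]exchange_big /= [X in _ + X]big1 ?addr0// => j _.
  rewrite -mulr_sumr; under eq_bigr do rewrite mxE.
  rewrite -mulr_sumr sumrB (bigD1 (p j))//= eqxx big1 => [|x]; last first.
    by rewrite eq_sym => /negbTE ->.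
  rewrite (bigD1 (q j))//= eqxx big1 => [|x]; last first.
    by rewrite eq_sym => /negbTE ->.
  by rewrite subrr !mulr0.
pose win (z : 'rV[R]_N) j := if z 0 j == 1 then p j else q j.
pose lose (z : 'rV[R]_N) j := if z 0 j == 1 then q j else p j.
have win_inj z : injective (win z).
  move=> i j; rewrite /win; case: ifP => _; case: ifP => _.
  - exact: p_inj.
  - by move/eqP; rewrite (negbTE (pq _ _)).
  - by move/esym/eqP; rewrite (negbTE (pq _ _)).
  - exact: q_inj.
have lose_inj z : injective (lose z).
  move=> i j; rewrite /lose; case: ifP => _; case: ifP => _.
  - exact: q_inj.
  - by move/esym/eqP; rewrite (negbTE (pq _ _)).
  - by move/eqP; rewrite (negbTE (pq _ _)).
  - exact: p_inj.
have win_lose z i j : win z i != lose z j.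
  apply/eqP; rewrite /win /lose; case: ifP => zi; case: ifP => zj.
  - by move/eqP; rewrite (negbTE (pq _ _)).
  - by move/p_inj => ij; rewrite ij zj in zi.
  - by move/q_inj => ij; rewrite ij zj in zi.
  - by move/esym/eqP; rewrite (negbTE (pq _ _)).
have wl z j : (win z j = p j /\ lose z j = q j) \/ (win z j = q j /\ lose z j = p j).
  by rewrite /win /lose; case: ifP => _; [left|right].
have winS z j : win z j \in S.
  by have [? ?] := pqS j; case: (wl z j) => -[-> _].
have loseS z j : lose z j \in S.
  by have [? ?] := pqS j; case: (wl z j) => -[_ ->].
have N1 : (-1 == 1 :> R) = false by apply/eqP; lra.
have f1win z j : is_signing z -> f1 z 0 (win z j) = 2 * a.
  move=> zs; rewrite /win; case: (zs j) => zj; rewrite zj ?eqxx ?N1.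
    by rewrite f1p zj; ring.
  by rewrite f1q zj; ring.
have f1lose z j : is_signing z -> f1 z 0 (lose z j) = 0.
  move=> zs; rewrite /lose; case: (zs j) => zj; rewrite zj ?eqxx ?N1.
    by rewrite f1q zj; ring.
  by rewrite f1p zj; ring.
pose S1 (z : 'rV[R]_N) := [set win z j | j : 'I_N].
have S1card z : #|S1 z| = N by rewrite card_imset ?card_ord.
have S1S z : S1 z \subset S by apply/fintype.subsetP => x /imsetP[j _ ->].
(* Stated for every z, with an empty list when z is not a signing, so that choice gives a kernel
   defined everywhere. *)
have step z : exists nu : seq (R * 'rV[R]_k), is_signing z ->
    is_law (halving_outcome r.+1 S f0) nu /\
    forall t, expect nu (fun f => expR (dot ((f - f0) *m h) t)) <=
      expR (dot (z *m (D *m h)) t) *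
      expR (4 * ((2 * a) ^+ 2 * (4 ^+ r.+1 - 4) * Hm) * dot t t).
  have [zs|nzs] := pselect (is_signing z); last by exists [::].
  have [|||nu nuP nub] := IH (2 * a) Hm (S1 z) (f1 z) _ Hm0.
  - by rewrite mulr_ge0.
  - by move=> x /imsetP[j _ ->]; exact: f1win.
  - by move=> x xS1; apply: hS; apply: (fintype.subsetP (S1S z)).
  exists nu => _; split=> [|t]; last first.
    apply: le_trans (ler_wpM2l (expR_ge0 _) (nub t)); rewrite -expectZ.
    rewrite le_eqVlt; apply/orP; left; apply/eqP; apply: eq_expect => f.
    have -> : (f - f0) *m h = z *m (D *m h) + (f - f1 z) *m h.
      rewrite mulmxA -mulmxDl; congr (_ *m _); apply/rowP => x.
      by rewrite !mxE; ring.
    by rewrite dotDl expRD.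
  split; last exact: nuP.2.
  move=> b /(nuP.1 b)[b0 [off fge0 fsum fzero]]; split=> //; split.
  - move=> x xS; rewrite off.
      by rewrite f1o// => j; apply: contraNneq xS => <-; have [] := pqS j.
    by apply: contra xS => /(fintype.subsetP (S1S z)).
  - move=> x xS; have [xS1|xS1] := boolP (x \in S1 z); first exact: fge0.
    rewrite off//; have [[j jx]|nx] := pselect (exists j, lose z j = x).
      by rewrite -jx f1lose.
    rewrite f1o ?f0S// => j; apply/eqP => jx; case: (wl z j) => -[w1 w2].
    + by move/negP: xS1; apply; rewrite -jx -w1 imset_f.
    + by apply: nx; exists j; rewrite w2.
    + by apply: nx; exists j; rewrite w2.
    + by move/negP: xS1; apply; rewrite -jx -w1 imset_f.
  - by rewrite fsum f1sum.
  (* The losers of this round are zeros that later rounds, played among the winners, do not touch;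
     the two families of zeros are disjoint. *)
  pose L := [set lose z j | j : 'I_N].
  have Lcard : #|L| = N by rewrite card_imset ?card_ord.
  have dis : [disjoint L & [set x in S1 z | b.2 0 x == 0]].
    rewrite finset.disjoints_subset; apply/fintype.subsetP => x /imsetP[j _ ->].
    rewrite !inE negb_and; apply/orP; left; apply/imsetP => -[i _] /esym/eqP.
    by rewrite (negbTE (win_lose _ _ _)).
  rewrite [halving_zeros _ _]/= -/N -{1}Lcard.
  apply: leq_trans (_ : #|L| + #|[set x in S1 z | (b.2 0 x == 0)%R]| <= _)%N.
    by rewrite leq_add2l -{1}(S1card z).
  rewrite -cardsUI (_ : L :&: _ = finset.set0) ?cards0 ?addn0; last first.
    by apply/eqP; rewrite finset.setI_eq0.
  apply: subset_leq_card; apply/fintype.subsetP => x; rewrite inE => /orP[].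
    move=> /imsetP[j _ ->]; rewrite inE loseS off ?f1lose ?eqxx//.
    by apply/imsetP => -[i _] /esym/eqP; rewrite (negbTE (win_lose _ _ _)).
  by rewrite !inE => /andP[/(fintype.subsetP (S1S z)) -> ->].
have [nu nuP] := boolp.choice step.
exists (law_bind mu nu).
  by apply: (is_law_bind muP) => z /nuP[].
move=> t; rewrite expect_bind.
set E := expR (4 * ((2 * a) ^+ 2 * (4 ^+ r.+1 - 4) * Hm) * dot t t).
apply: (@le_trans _ _ (expect mu (fun z => E * expR (dot (z *m (D *m h)) t)))).
  by apply: (expect_le muP) => z /nuP[_ /(_ t)]; rewrite mulrC.
rewrite expectZ; apply: le_trans (ler_wpM2l (expR_ge0 _) (mub t)) _.
rewrite /E -expRD ler_expR -mulrDl ler_wpM2r ?dot_ge0// exprMn.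
have : 0 <= a ^+ 2 * Hm by rewrite mulr_ge0// sqr_ge0.
by rewrite (exprS 4 r.+1); lra.
Qed.

Lemma halving_zeros_ge1 r s : (0 < r)%N -> (2 <= s)%N -> (1 <= halving_zeros r s)%N.
Proof.
case: r => // r _ s2; rewrite /= (leq_trans _ (leq_addr _ _))//.
by rewrite half_gt0.
Qed.

(** Perfect halving would leave s / 2^r survivors; each round leaves out at most one unpaired
    element. *)
Lemma halving_zeros_lb r s :
  s%:R - s%:R / 2 ^+ r - r%:R <= (halving_zeros r s)%:R :> R.
Proof.
elim: r s => [|r IH] s; first by rewrite expr0 divr1 subrr subr0.
rewrite [halving_zeros _ _]/= natrD; have := IH s./2.
have h1 : s%:R - 1 <= s./2%:R + s./2%:R :> R.
  rewrite lerBlDr -!natrD natr1 ler_nat addnn -{1}(odd_double_half s) -addn1 addnC.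
  by rewrite leq_add2l; case: odd.
have h2 : s./2%:R / 2 ^+ r <= s%:R / 2 ^+ r.+1 :> R.
  rewrite exprS invfM mulrA ler_wpM2r ?invr_ge0 ?exprn_ge0//.
  rewrite ler_pdivlMr// -natrM ler_nat.
  by rewrite -[leqRHS](odd_double_half s) muln2 leq_addl.
rewrite -[r.+1%:R]natr1; lra.
Qed.

End Halving.

(** * Comparison with Gaussians *)

Section GaussianTrick.
Variable R : realType.

Lemma normal_pdf1E (m s x : R) : s != 0 ->
  normal_pdf m s x = normal_peak s * expR (- (x - m) ^+ 2 / (2 * s ^+ 2)).
Proof. by move=> s0; rewrite normal_pdfE//= /normal_fun mulr_natl. Qed.

Lemma normal_peakV (s : R) : 0 < s -> normal_peak s^-1 = s * normal_peak (1 : R).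
Proof.
move=> s0; rewrite /normal_peak expr1n mul1r.
have -> : s^-1 ^+ 2 * pi *+ 2 = (s ^+ 2)^-1 * (pi *+ 2).
  by rewrite exprVn; exact/esym/mulrnAr.
rewrite sqrtrM ?invr_ge0 ?sqr_ge0// invfM; congr (_ * _).
by rewrite sqrtrV ?sqr_ge0// invrK sqrtr_sqr gtr0_norm.
Qed.

(* Integrating a subgaussian bound against a standard normal variable turns a
   linear exponent into a quadratic one. *)
Lemma gaussian_linearization (I : Type) (s : seq I) (c l : I -> R)
    (K v tau b : R) :
  (forall i, 0 <= c i) -> 0 <= K -> 0 <= tau -> 0 <= v -> v * tau < 1 ->
  (forall xi, \sum_(i <- s) c i * expR (xi * l i) <=
              K * expR (v / 2 * (b + xi) ^+ 2)) ->
  \sum_(i <- s) c i * expR (tau / 2 * l i ^+ 2) <=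
  K * (Num.sqrt (1 - v * tau))^-1 * expR (v / (1 - v * tau) / 2 * b ^+ 2).
Proof.
move=> c0 K0 t0 v0 vt h.
set q := Num.sqrt (1 - v * tau); set rt := Num.sqrt tau.
have rt2 : rt ^+ 2 = tau by rewrite sqr_sqrtr.
have u0 : 0 < 1 - v * tau by lra.
have q0 : 0 < q by rewrite sqrtr_gt0.
have q2 : q ^+ 2 = 1 - v * tau by rewrite sqr_sqrtr// ltW.
have one0 : (1 : R) != 0 by exact: oner_neq0.
have qV0 : q^-1 != 0 by rewrite invr_neq0// gt_eqF.
(* Put xi = [rt * g] with g standard normal and complete the squares. Each term on the left becomes
   a normal density of mean [rt * l i], the right side one of mean [m] and standard deviation
   [q^-1], and all of them integrate to 1. *)
pose m := v * b * rt / (1 - v * tau).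
have lin i g : c i * expR (tau / 2 * l i ^+ 2) * normal_pdf (rt * l i) 1 g =
    c i * expR (rt * g * l i) * normal_pdf 0 1 g.
  rewrite !normal_pdf1E// -!mulrA; congr (_ * _).
  rewrite ![_ * (normal_peak 1 * _)]mulrCA; congr (_ * _).
  by rewrite -!expRD; congr expR; rewrite -rt2; field.
have quad g : K * expR (v / 2 * (b + rt * g) ^+ 2) * normal_pdf 0 1 g =
    K * q^-1 * expR (v / (1 - v * tau) / 2 * b ^+ 2) * normal_pdf m q^-1 g.
  have regroup (pk eA eB eC eD : R) : eA * eB = eC * eD ->
      K * eA * (pk * eB) = K * q^-1 * eC * (q * pk * eD).
    move=> eAB; transitivity (K * pk * (eA * eB)); first by ring.
    by rewrite eAB; field; rewrite gt_eqF.
  rewrite !normal_pdf1E// normal_peakV//; apply: regroup.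
  rewrite -!expRD; congr expR.
  rewrite exprVn q2 /m -rt2; field.
  by rewrite rt2 gt_eqF.
rewrite -lee_fin.
have mul_pdf k m' s' : 0 <= k ->
    (k%:E = \int[@lebesgue_measure R]_g (k * normal_pdf m' s' g)%:E)%E.
  move=> k0; under eq_integral do rewrite EFinM.
  rewrite ge0_integralZl_EFin// ?integral_normal_pdf ?mule1//.
    by move=> x _; rewrite lee_fin normal_pdf_ge0.
  by apply/measurable_EFinP; exact: measurable_normal_pdf.
rewrite (mul_pdf (K * _ * _) m q^-1); last by rewrite !mulr_ge0 ?expR_ge0// invr_ge0 ltW.
rewrite -sumEFin.
under eq_bigr => i _ do
  rewrite (mul_pdf (c i * expR (tau / 2 * l i ^+ 2)) (rt * l i) 1) ?mulr_ge0 ?expR_ge0//.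
rewrite -(ge0_integral_sum _ _ _ _ s)//=; last 2 first.
- move=> i; apply/measurable_EFinP; apply: measurable_funM => //.
  exact: measurable_normal_pdf.
- by move=> i x _; rewrite lee_fin mulr_ge0 ?normal_pdf_ge0// mulr_ge0 ?expR_ge0.
apply: ge0_le_integral => //.
- move=> x _; apply: sume_ge0 => i _.
  by rewrite lee_fin mulr_ge0 ?normal_pdf_ge0// mulr_ge0 ?expR_ge0.
- apply: emeasurable_sum => i; apply/measurable_EFinP; apply: measurable_funM => //.
  exact: measurable_normal_pdf.
- by apply/measurable_EFinP; apply: measurable_funM => //; exact: measurable_normal_pdf.
move=> g _; rewrite sumEFin lee_fin -quad; under eq_bigr do rewrite lin.
by rewrite -mulr_suml ler_wpM2r ?normal_pdf_ge0.
Qed.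

(** The squared norm is built up one coordinate at a time. A free linear term t is kept throughout,
    as the hypothesis of the next Gaussian integration; each coordinate treated costs a factor q and
    turns its coefficient v into v / (1 - v^2). The claim is the case t = 0. *)
Lemma subgaussian_square (T : eqType) (P : T -> Prop) (mu : seq (R * T)) (d : nat)
    (s : T -> 'rV[R]_d) (v : R) :
  is_law P mu -> 0 <= v -> v ^+ 2 < 1 ->
  (forall t, expect mu (fun z => expR (dot (s z) t)) <= expR (v / 2 * dot t t)) ->
  expect mu (fun z => expR (v / 2 * dot (s z) (s z))) <=
  (Num.sqrt (1 - v ^+ 2))^-1 ^+ d.
Proof.
move=> muP v0 v1 sub.
have u0 : 0 < 1 - v ^+ 2 by lra.
set q := (Num.sqrt _)^-1.
have q0 : 0 <= q by rewrite invr_ge0 sqrtr_ge0.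
pose a := v / (1 - v * v).
have vE : v * v = v ^+ 2 by rewrite expr2.
(* [gaussian_linearization] wants weights nonnegative at every index, while [is_law] speaks only of
   the listed ones. *)
have absE f : expect mu f = \sum_(b <- mu) `|b.1| * f b.2.
  rewrite /expect big_seq [RHS]big_seq; apply: eq_bigr => b bmu.
  by have [b0 _] := muP.1 b bmu; rewrite ger0_norm.
suff step m : (m <= d)%N -> forall t : 'rV[R]_d,
    expect mu (fun z => expR (dot (s z) t) *
       expR (v / 2 * \sum_(i < d | (i < m)%N) s z 0 i ^+ 2)) <=
    q ^+ m * expR (\sum_(i < d) (if (i < m)%N then a else v) / 2 * t 0 i ^+ 2).
  have := step d (leqnn d) 0.
  rewrite [in leRHS]big1 => [|i _]; last by rewrite mxE expr0n mulr0.
  rewrite expR0 mulr1; congr (_ <= _); apply: eq_expect => z.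
  rewrite dotC dot0l expR0 mul1r /dot; congr (expR (_ * _)).
  by apply: eq_big => i; rewrite ?ltn_ord// expr2.
elim: m => [_ t|m IH md t].
  rewrite expr0 mul1r; have := sub t.
  congr (_ <= _).
    by apply: eq_expect => z; rewrite big_pred0// mulr0 expR0 mulr1.
  by congr expR; rewrite /dot mulr_sumr; apply: eq_bigr => i _; rewrite expr2.
pose j := Ordinal md.
pose e := delta_mx 0 j : 'rV[R]_d.
pose rest := \sum_(i < d | i != j) (if (i < m.+1)%N then a else v) / 2 * t 0 i ^+ 2.
have dote z : dot (s z) e = s z 0 j.
  rewrite /dot (bigD1 j)//= big1 ?addr0 => [|i ij]; last by rewrite mxE (negbTE ij) andbF mulr0.
  by rewrite mxE !eqxx mulr1.
rewrite absE.
have -> : \sum_(b <- mu) `|b.1| * (expR (dot (s b.2) t) *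
      expR (v / 2 * \sum_(i < d | (i < m.+1)%N) s b.2 0 i ^+ 2)) =
    \sum_(b <- mu) `|b.1| * (expR (dot (s b.2) t) *
      expR (v / 2 * \sum_(i < d | (i < m)%N) s b.2 0 i ^+ 2)) *
      expR (v / 2 * s b.2 0 j ^+ 2).
  apply: eq_bigr => b _; rewrite -!mulrA; congr (_ * (_ * _)); rewrite -expRD; congr expR.
  rewrite (bigD1 j)//= (eq_bigl (fun i : 'I_d => (i < m)%N)); first by ring.
  by move=> i; rewrite ltnS [in RHS]ltn_neqAle andbC.
have := @gaussian_linearization _ mu (fun b => `|b.1| * (expR (dot (s b.2) t) *
      expR (v / 2 * \sum_(i < d | (i < m)%N) s b.2 0 i ^+ 2)))
  (fun b => s b.2 0 j) (q ^+ m * expR rest) v v (t 0 j).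
move=> /(_ _ _ v0 v0); rewrite vE => H.
apply: le_trans (H _ _ v1 _) _.
- by move=> b; rewrite !mulr_ge0 ?expR_ge0.
- by rewrite mulr_ge0 ?expR_ge0 ?exprn_ge0.
- move=> xi; have := IH (ltnW md) (t + xi *: e).
  congr (_ <= _).
    rewrite absE; apply: eq_bigr => b _; rewrite dotDr dotZr dote expRD.
    ring.
  rewrite -[RHS]mulrA -expRD; congr (_ * expR _).
  rewrite (bigD1 j)//= ltnn addrC; congr (_ + _).
    apply: eq_bigr => i ij; rewrite !mxE (negbTE ij) andbF mulr0 addr0.
    by rewrite ltnS [in RHS]leq_eqVlt -[_ == m]/(i == j) (negbTE ij).
  by rewrite !mxE !eqxx mulr1.
rewrite -/q (bigD1 j)//= ltnSn /a vE expRD -/rest.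
rewrite le_eqVlt; apply/orP; left; apply/eqP.
by rewrite [in RHS]exprSr; ring.
Qed.

End GaussianTrick.

(** * Independent private coins *)

Section BoundedExpectation.
Variables (R : realType) (dO : measure_display) (Omega : measurableType dO).
Variable P : probability Omega R.
Implicit Types X Y : Omega -> R.

Definition unit_rv X := measurable_fun setT X /\ forall w, 0 <= X w <= 1.

Definition rexp X : R := fine (\int[P]_w (X w)%:E)%E.

Lemma rexpE X : unit_rv X -> (\int[P]_w (X w)%:E = (rexp X)%:E)%E.
Proof.
move=> [mX X01]; rewrite /rexp fineK// ge0_fin_numE; last first.
  by apply: integral_ge0 => w _; rewrite lee_fin; have /andP[] := X01 w.
apply: (@le_lt_trans _ _ (\int[P]_w (cst 1%E w))%E); last first.
  by rewrite integral_cst//= probability_setT mule1 ltry.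
apply: ge0_le_integral => //.
- by move=> w _; rewrite lee_fin; have /andP[] := X01 w.
- exact/measurable_EFinP.
- by move=> w _; rewrite lee_fin; have /andP[] := X01 w.
Qed.

Lemma rexp_cst c : rexp (fun=> c) = c.
Proof. by rewrite /rexp (integral_cst P measurableT c%:E) /= probability_setT mule1. Qed.

Lemma rexp_le X Y c : unit_rv X -> unit_rv Y -> 0 <= c ->
  (forall w, X w <= Y w + c) -> rexp X <= rexp Y + c.
Proof.
move=> uX uY c0 XY; rewrite -lee_fin EFinD -!rexpE//.
have -> : c%:E = (\int[P]_w (cst c%:E w))%E.
  by rewrite integral_cst//= probability_setT mule1.
rewrite -ge0_integralD//; first last.
- by apply/measurable_EFinP; exact: uY.1.
- by move=> w _; rewrite lee_fin; have /andP[] := uY.2 w.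
apply: ge0_le_integral => //.
- by move=> w _; rewrite lee_fin; have /andP[] := uX.2 w.
- by apply/measurable_EFinP; exact: uX.1.
- by apply/measurable_EFinP/measurable_funD => //; exact: uY.1.
- by move=> w _; rewrite lee_fin; exact: XY.
Qed.

Lemma rexp01 X : unit_rv X -> 0 <= rexp X <= 1.
Proof.
move=> uX.
have u0 : unit_rv (fun=> 0) by split=> // w; rewrite lexx ler01.
have u1 : unit_rv (fun=> 1) by split=> // w; rewrite lexx ler01.
apply/andP; split.
  have := @rexp_le _ _ 0 u0 uX (lexx _); rewrite rexp_cst addr0; apply => w.
  by rewrite addr0; have /andP[] := uX.2 w.
have := @rexp_le _ _ 0 uX u1 (lexx _); rewrite rexp_cst addr0; apply => w.
by have /andP[] := uX.2 w.
Qed.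

Lemma integral_comb (I : Type) (s : seq I) (c : I -> R) (X : I -> Omega -> R) :
  (forall i, 0 <= c i) -> (forall i, unit_rv (X i)) ->
  (\int[P]_w (\sum_(i <- s) c i * X i w)%:E = (\sum_(i <- s) c i * rexp (X i))%:E)%E.
Proof.
move=> c0 uX; under eq_integral do rewrite -sumEFin.
rewrite ge0_integral_sum//; last 2 first.
- move=> i; apply/measurable_EFinP; apply: measurable_funM => //; exact: (uX i).1.
- by move=> i w _; rewrite lee_fin mulr_ge0//; have /andP[] := (uX i).2 w.
rewrite -sumEFin; apply: eq_bigr => i _; under eq_integral do rewrite EFinM.
rewrite ge0_integralZl_EFin//; last 2 first.
- by move=> w _; rewrite lee_fin; have /andP[] := (uX i).2 w.
- by apply/measurable_EFinP; exact: (uX i).1.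
by rewrite rexpE.
Qed.

Lemma rexp_comb (I : Type) (s : seq I) (c : I -> R) (X : I -> Omega -> R) :
  (forall i, 0 <= c i) -> (forall i, unit_rv (X i)) ->
  rexp (fun w => \sum_(i <- s) c i * X i w) = \sum_(i <- s) c i * rexp (X i).
Proof. by move=> c0 uX; rewrite /rexp integral_comb. Qed.

Lemma unit_rv_prod (I : finType) (X : I -> Omega -> R) :
  (forall i, unit_rv (X i)) -> unit_rv (fun w => \prod_i X i w).
Proof.
move=> uX; split; first by apply: measurable_prod => i _; exact: (uX i).1.
move=> w; apply/andP; split; last by apply: prodr_ile1 => i _; exact: (uX i).2.
by apply: prodr_ge0 => i _; have /andP[] := (uX i).2 w.
Qed.

End BoundedExpectation.

Section Discretization.
Variable R : realType.

Lemma natr_bool01 (b : bool) : 0 <= (b%:R : R) <= 1.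
Proof. by case: b; rewrite /= ?lexx ?ler01. Qed.

(* A sum of indicators of the events [y >= j / N], to which the independence of
   events applies. *)
Definition round_down (N : nat) (y : R) : R :=
  \sum_(j < N) N%:R^-1 * (j.+1%:R <= N%:R * y)%R%:R.

Lemma round_downP N (y : R) : (0 < N)%N -> 0 <= y <= 1 ->
  0 <= round_down N y <= y /\ y <= round_down N y + N%:R^-1.
Proof.
move=> N0 /andP[y0 y1]; have NR : 0 < N%:R :> R by rewrite ltr0n.
have Ny0 : 0 <= N%:R * y by rewrite mulr_ge0.
set m := Num.trunc (N%:R * y).
have mN : (m <= N)%N.
  by rewrite -(ler_nat R); apply: le_trans (_ : N%:R * y <= _);
    [rewrite -truncn_ge_nat|rewrite ler_piMr// ltW].
have -> : round_down N y = N%:R^-1 * m%:R.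
  rewrite /round_down -mulr_sumr; congr (_ * _).
  under eq_bigr do rewrite -truncn_gt_nat -/m.
  rewrite -natr_sum -big_mkcond /= -(big_ord_widen N (fun=> 1%N) mN).
  by rewrite sum1_card card_ord.
have -> /= : 0 <= N%:R^-1 * m%:R :> R by rewrite mulr_ge0// invr_ge0.
split.
  by rewrite ler_pdivrMl// -truncn_ge_nat.
have := ltnSn m; rewrite {2}/m ltnNge truncn_gt_nat -ltNge -natr1 => my.
rewrite -[X in _ + X]mulr1 -mulrDr ler_pdivlMl// ltW//.
Qed.

Lemma prod_perturb (I : Type) (s : seq I) (a b : I -> R) (e : R) :
  0 <= e -> (forall i, 0 <= a i <= b i) -> (forall i, b i <= 1) ->
  (forall i, b i <= a i + e) ->
  \prod_(i <- s) b i <= \prod_(i <- s) a i + (size s)%:R * e.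
Proof.
move=> e0 ab b1 be; elim: s => [|i s IH].
  by rewrite !big_nil mul0r addr0.
rewrite !big_cons /= -natr1.
have A0 : 0 <= \prod_(j <- s) a j by apply: prodr_ge0 => j _; have /andP[] := ab j.
have A1 : \prod_(j <- s) a j <= 1.
  apply: prodr_ile1 => j _; have /andP[-> h] := ab j; exact: le_trans (b1 j).
have B0 : 0 <= b i by have /andP[h1 h2] := ab i; exact: le_trans h2.
apply: le_trans (ler_wpM2l B0 IH) _.
have h1 : b i * \prod_(j <- s) a j <= (a i + e) * \prod_(j <- s) a j.
  by rewrite ler_wpM2r.
have h2 : e * \prod_(j <- s) a j <= e by rewrite ler_piMr.
have h3 : b i * ((size s)%:R * e) <= (size s)%:R * e by rewrite ler_piMl// mulr_ge0.
lra.
Qed.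

Lemma prod_perturb_ord n (a b : 'I_n -> R) (e : R) :
  0 <= e -> (forall i, 0 <= a i <= b i) -> (forall i, b i <= 1) ->
  (forall i, b i <= a i + e) ->
  \prod_i b i <= \prod_i a i + n%:R * e.
Proof.
move=> e0 ab b1 be; have := prod_perturb (index_enum 'I_n) e0 ab b1 be.
have -> : size (index_enum 'I_n) = n by rewrite -[RHS]card_ord cardT enumT.
by [].
Qed.

End Discretization.

Section IndependentProduct.
Variables (R : realType) (n : nat) (dO : measure_display).
Variables (Omega : measurableType dO) (P : probability Omega R).
Variables (e : 'I_n -> measure_display) (V : forall i, measurableType (e i)).
Variable U : forall i, Omega -> V i.
Hypothesis mU : forall i, measurable_fun setT (U i).
Hypothesis indU : mutually_independent P U.
Variable g : forall i, V i -> R.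
Hypothesis mg : forall i, measurable_fun setT (@g i).
Hypothesis g01 : forall i v, 0 <= @g i v <= 1.

Lemma unit_rv_comp i : unit_rv (fun w => g (U i w)).
Proof. by split=> [|w]; [exact: measurableT_comp|exact: g01]. Qed.

Let level N i (j : 'I_N) : set (V i) := [set v | j.+1%:R <= N%:R * g v].

Let measurable_level N i (j : 'I_N) : measurable (@level N i j).
Proof.
rewrite /level -[X in measurable X]setTI.
have mNg : measurable_fun setT (fun v : V i => N%:R * g v).
  by apply: measurable_funM => //; exact: mg.
have := mNg measurableT `[j.+1%:R, +oo[%classic (measurable_itv _).
by congr (measurable (_ `&` _)); apply/seteqP; split=> v /=; rewrite in_itv/= andbT.
Qed.

Let unit_rv_level N i (j : 'I_N) :
  unit_rv (fun w => (j.+1%:R <= N%:R * g (U i w))%R%:R : R).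
Proof.
split=> [|w]; last exact: natr_bool01.
rewrite (_ : (fun w => _) = \1_(U i @^-1` @level N i j)); last first.
  apply/funext => w; rewrite indicE /level /=; congr ((nat_of_bool _)%:R).
  by apply/idP/idP; rewrite inE.
by apply: measurable_indic; rewrite -[X in measurable X]setTI; exact: mU.
Qed.

Let rexp_level_prod N (J : {ffun 'I_n -> 'I_N}) :
  rexp P (fun w => \prod_i ((J i).+1%:R <= N%:R * g (U i w))%R%:R) =
  \prod_i rexp P (fun w => ((J i).+1%:R <= N%:R * g (U i w))%R%:R).
Proof.
have mA i : measurable (U i @^-1` @level N i (J i)).
  by rewrite -[X in measurable X]setTI; exact: mU.
have rexp_ind (A : set Omega) (f : Omega -> bool) : measurable A ->
    (forall w, f w <-> A w) -> (P A = (rexp P (fun w => (f w)%:R))%:E)%E.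
  move=> mA' fA; rewrite -[A]setIT -integral_indic// -rexpE.
    apply: eq_integral => w _; rewrite indicE; congr ((nat_of_bool _)%:R%:E).
    by apply/idP/idP; rewrite inE => /fA.
  split=> [|w]; last exact: natr_bool01.
  rewrite (_ : (fun w => _) = \1_A); first exact: measurable_indic.
  apply/funext => w; rewrite indicE; congr ((nat_of_bool _)%:R).
  by apply/idP/idP; rewrite inE => /fA.
apply: EFin_inj; rewrite -prodEFin.
have -> : rexp P (fun w => \prod_i ((J i).+1%:R <= N%:R * g (U i w))%R%:R) =
    rexp P (fun w => [forall i, (J i).+1%:R <= N%:R * g (U i w)]%R%:R).
  congr rexp; apply/funext => w; case: forallP => [h|h].
    by rewrite big1// => i _; rewrite h.
  have [i hi] : exists i, ~~ ((J i).+1%:R <= N%:R * g (U i w)).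
    by apply/existsP; rewrite -negb_forall; apply/forallP.
  by rewrite (bigD1 i)//= (negbTE hi) mul0r.
have := indU [set: 'I_n]%SET (fun i => @measurable_level N i (J i)).
set A := (X in P X = _) => indA.
have mA' : measurable A.
  by apply: fin_bigcap_measurable => [|i _ //]; exact: finite_finset.
rewrite -(rexp_ind A) => [|//|w]; last first.
  split=> [/forallP allw i _|Aw]; first exact: allw.
  by apply/forallP => i; apply: Aw; rewrite /= inE.
rewrite indA; apply: eq_big => [i|i _]; first by rewrite inE.
exact: rexp_ind.
Qed.

(** Independence is available for events only. For the roundings to N levels the product expands
    into indicators of intersections and the identity is exact; rounding costs at most n / N on
    either side, for every N. *)
Lemma rexp_prod_indep :
  rexp P (fun w => \prod_i g (U i w)) = \prod_i rexp P (fun w => g (U i w)).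
Proof.
pose gN N i (w : Omega) := round_down N (g (U i w)).
have gNE N i w : gN N i w = round_down N (g (U i w)) by [].
have rexp_gN N i : rexp P (gN N i) =
    \sum_(j < N) N%:R^-1 * rexp P (fun w => (j.+1%:R <= N%:R * g (U i w))%R%:R).
  by apply: rexp_comb => j; [rewrite invr_ge0|exact: unit_rv_level].
have ugN N i : (0 < N)%N -> unit_rv (gN N i).
  move=> N0; split=> [|w].
    apply: measurable_sum => j; apply: measurable_funM => //.
    exact: (unit_rv_level _ _).1.
  have [/andP[h1 h2] _] := round_downP N0 (g01 (U i w)).
  by rewrite h1 (le_trans h2)//; have /andP[] := g01 (U i w).
have prod_gN N : (0 < N)%N ->
    rexp P (fun w => \prod_i gN N i w) = \prod_i rexp P (gN N i).
  move=> N0; under [RHS]eq_bigr do rewrite rexp_gN.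
  rewrite bigA_distr_bigA /=.
  transitivity (rexp P (fun w => \sum_(J : {ffun 'I_n -> 'I_N})
     (N%:R^-1 ^+ n) * \prod_i ((J i).+1%:R <= N%:R * g (U i w))%R%:R)).
    congr rexp; apply/funext => w; rewrite /gN /round_down bigA_distr_bigA /=.
    by apply: eq_bigr => J _; rewrite big_split /= prodr_const card_ord.
  rewrite rexp_comb; last 2 first.
  - by move=> J; rewrite exprn_ge0// invr_ge0.
  - by move=> J; apply: unit_rv_prod => i; exact: unit_rv_level.
  apply: eq_bigr => J _; rewrite rexp_level_prod big_split /= prodr_const.
  by rewrite card_ord.
have u := unit_rv_comp; have up := unit_rv_prod u.
suff close N : (0 < N)%N -> `|rexp P (fun w => \prod_i g (U i w)) -
    \prod_i rexp P (fun w => g (U i w))| <= n%:R * N%:R^-1.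
  apply/eqP; rewrite -subr_eq0 -normr_eq0; set D := `|_| in close *.
  apply/negP => /negP D0; have Dp : 0 < D by rewrite lt0r D0 normr_ge0.
  have := truncn_gt_nat (n%:R / D) (Num.trunc (n%:R / D)).
  rewrite ltnn => /esym/negbT; rewrite -ltNge ltr_pdivrMr// => h.
  have := close _ (ltn0Sn (Num.trunc (n%:R / D))).
  by rewrite ler_pdivlMr ?ltr0n// leNgt mulrC h.
move=> N0; have NV : 0 <= N%:R^-1 :> R by rewrite invr_ge0.
have rd i w := round_downP N0 (g01 (U i w)).
have lo : rexp P (fun w => \prod_i gN N i w) <= rexp P (fun w => \prod_i g (U i w)).
  rewrite -[leRHS]addr0; apply: rexp_le => //.
    by apply: unit_rv_prod => i; exact: ugN.
  by move=> w; rewrite addr0; apply: ler_prod => i _; have [] := rd i w.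
have hi : rexp P (fun w => \prod_i g (U i w)) <=
    rexp P (fun w => \prod_i gN N i w) + n%:R * N%:R^-1.
  apply: rexp_le => //; first by apply: unit_rv_prod => i; exact: ugN.
  move=> w; apply: prod_perturb_ord => // i; have [h1 h2] := rd i w => //.
  by have /andP[] := g01 (U i w).
have r i : 0 <= rexp P (gN N i) <= rexp P (fun w => g (U i w)).
  have /andP[-> _] := rexp01 P (ugN _ i N0).
  rewrite -[leRHS]addr0; apply: rexp_le => //; first exact: ugN.
  by move=> w; rewrite addr0; have [/andP[]] := rd i w.
have lo' : \prod_i rexp P (gN N i) <= \prod_i rexp P (fun w => g (U i w)).
  by apply: ler_prod => i _; exact: r.
have hi' : \prod_i rexp P (fun w => g (U i w)) <=
    \prod_i rexp P (gN N i) + n%:R * N%:R^-1.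
  apply: prod_perturb_ord => // i.
    by have /andP[] := rexp01 P (u i).
  apply: rexp_le => //; first exact: ugN.
  by move=> w; have [] := rd i w.
rewrite prod_gN// in lo hi.
by rewrite ler_norml; apply/andP; split; lra.
Qed.

End IndependentProduct.

(** * The chi-square bound *)

Section AveragedChannels.
Variables (R : realType) (k : nat) (Y : finType) (F : set (channel R 'I_k Y)) (n : nat).
Variable prot : private_coin_protocol F n.

Definition message_prob (V : 'I_n -> 'I_k -> Y -> R) (p : 'I_k -> R)
    (B : pred {ffun 'I_n -> Y}) : R :=
  \sum_(y | B y) \prod_i \sum_x p x * V i x (y i).

(* The messages are independent once the private coins are averaged out. *)
Lemma decision_probE : exists V : 'I_n -> 'I_k -> Y -> R,
  [/\ forall i x y, 0 <= V i x y, forall i x, \sum_y V i x y = 1 &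
      forall T p b, decision_prob prot T p b =
        (message_prob V p [pred y | T y == b])%:E].
Proof.
have ch1 i v x y : 0 <= @player_channel _ _ _ _ _ prot i v x y <= 1.
  apply/andP; split; first exact: Defs.pmf_ge0.
  rewrite -(pmf_sum1 (player_channel v x)) (bigD1 y)//= lerDl.
  by apply: sumr_ge0 => z _; exact: Defs.pmf_ge0.
have uch i x y : unit_rv (fun w => player_channel (@seed _ _ _ _ _ prot i w) x y).
  split=> // ; apply: (measurableT_comp (player_channel_measurable x y)).
  exact: seed_measurable.
pose V i x y := rexp (coin_prob prot) (fun w => player_channel (@seed _ _ _ _ _ prot i w) x y).
exists V; split.
- by move=> i x y; have /andP[] := rexp01 (coin_prob prot) (uch i x y).
- move=> i x; rewrite -[RHS](rexp_cst (coin_prob prot) 1).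
  transitivity (\sum_y 1 * V i x y); first by apply: eq_bigr => y _; rewrite mul1r.
  rewrite -rexp_comb//; congr rexp; apply/funext => w.
  rewrite -[RHS](pmf_sum1 (player_channel (@seed _ _ _ _ _ prot i w) x)).
  by apply: eq_bigr => y _; rewrite mul1r.
move=> T p b; rewrite /decision_prob unlock.
pose g (y : {ffun 'I_n -> Y}) i v : R := \sum_x p x * @player_channel _ _ _ _ _ prot i v x (y i).
have mg y i : measurable_fun setT (g y i).
  apply: measurable_sum => x; apply: measurable_funM => //.
  exact: player_channel_measurable.
have g01 y i v : 0 <= g y i v <= 1.
  apply/andP; split.
    by apply: sumr_ge0 => x _; rewrite mulr_ge0//; exact: Defs.pmf_ge0.
  rewrite -(pmf_sum1 p); apply: ler_sum => x _; rewrite ler_piMr//; first exact: Defs.pmf_ge0.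
  by have /andP[] := ch1 i v x (y i).
(* For fixed seeds and messages the sum over the inputs factors over the players, each factor
   depending on one seed only. *)
transitivity (\int[coin_prob prot]_w (\sum_y (T y == b)%:R *
    \prod_i g y i (@seed _ _ _ _ _ prot i w))%:E)%E.
  apply: eq_integral => w _; congr EFin; rewrite exchange_big /= big_mkcond /=.
  apply: eq_bigr => y _; case: eqP => _; last by rewrite mul0r.
  by rewrite mul1r /g bigA_distr_bigA.
rewrite integral_comb//; last first.
  move=> y; apply: unit_rv_prod => i.
  exact: (unit_rv_comp (@seed_measurable _ _ _ _ _ prot) (mg y) (g01 y)).
congr EFin; rewrite /message_prob [RHS]big_mkcond /=; apply: eq_bigr => y _.
case: eqP => _; last by rewrite mul0r.
rewrite mul1r (rexp_prod_indep (@seed_measurable _ _ _ _ _ prot)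
  (@seed_independent _ _ _ _ _ prot) (mg y) (g01 y)).
apply: eq_bigr => i _; rewrite rexp_comb// => x; exact: Defs.pmf_ge0.
Qed.

End AveragedChannels.

Section ChiSquare.
Variables (R : realType) (k : nat) (Y : finType) (n : nat).
Variable V : 'I_n -> 'I_k -> Y -> R.
Hypothesis k_gt0 : (0 < k)%N.
Hypothesis V0 : forall i x y, 0 <= V i x y.
Hypothesis V1 : forall i x, \sum_y V i x y = 1.
Implicit Types (f : 'rV[R]_k).

Definition null_msg i y : R := \sum_x k%:R^-1 * V i x y.

Definition perturbed f x : R := (1 + f 0 x) / k%:R.

Definition shift_msg f i y : R := \sum_x f 0 x / k%:R * V i x y.

(* The chi-square inner product of the message laws of two perturbations is the
   inner product of their images under [score]. A message [y] of null probability
   gives a zero column, as every [V i x y] then vanishes. *)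
Definition score : 'M[R]_(k, #|{: 'I_n * Y}|) :=
  \matrix_(x, c) (V (enum_val c).1 x (enum_val c).2 /
    (k%:R * Num.sqrt (null_msg (enum_val c).1 (enum_val c).2))).

Lemma kR_gt0 : 0 < k%:R :> R. Proof. by rewrite ltr0n. Qed.

Lemma null_msg_ge0 i y : 0 <= null_msg i y.
Proof. by apply: sumr_ge0 => x _; rewrite mulr_ge0// invr_ge0. Qed.

Lemma null_msg_eq0 i y : null_msg i y = 0 -> forall x, V i x y = 0.
Proof.
move/eqP; rewrite psumr_eq0 => [/allP h x|x _]; last by rewrite mulr_ge0// invr_ge0.
have /eqP/eqP := h x (mem_index_enum _); rewrite mulf_eq0 invr_eq0.
by rewrite (gt_eqF kR_gt0)/= => /eqP.
Qed.

Lemma null_msg_sum i : \sum_y null_msg i y = 1.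
Proof.
rewrite exchange_big /=; under eq_bigr do rewrite -mulr_sumr V1 mulr1.
by rewrite sumr_const card_ord -[_ *+ k]mulr_natr mulVf// gt_eqF// kR_gt0.
Qed.

Lemma perturbed_msg f i y :
  \sum_x perturbed f x * V i x y = null_msg i y + shift_msg f i y.
Proof.
rewrite -big_split; apply: eq_bigr => x _ /=.
by rewrite /perturbed mulrDl mulrDl mul1r.
Qed.

Lemma shift_msg_sum f i : \sum_x f 0 x = 0 -> \sum_y shift_msg f i y = 0.
Proof.
move=> f0; rewrite exchange_big /=; under eq_bigr do rewrite -mulr_sumr V1 mulr1.
by rewrite -mulr_suml f0 mul0r.
Qed.

Lemma shift_msg0 f i y : null_msg i y = 0 -> shift_msg f i y = 0.
Proof. by move=> /null_msg_eq0 P0; rewrite /shift_msg big1// => x _; rewrite P0 mulr0. Qed.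

Lemma dot_score f f' : dot (f *m score) (f' *m score) =
  \sum_i \sum_y shift_msg f i y * shift_msg f' i y / null_msg i y.
Proof.
have E h c : (h *m score) 0 c = shift_msg h (enum_val c).1 (enum_val c).2 /
    Num.sqrt (null_msg (enum_val c).1 (enum_val c).2).
  rewrite mxE mulr_suml; apply: eq_bigr => x _; rewrite mxE invfM; ring.
rewrite /dot; under eq_bigr do rewrite !E.
pose G (z : 'I_n * Y) := shift_msg f z.1 z.2 * shift_msg f' z.1 z.2 / null_msg z.1 z.2.
transitivity (\sum_(c < #|{: 'I_n * Y}|) G (enum_val c)).
  apply: eq_bigr => c _; rewrite /G mulrACA -invfM -expr2 sqr_sqrtr//.
  exact: null_msg_ge0.
rewrite -(big_enum_val G) pair_bigA /=.
by apply: eq_big => -[].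
Qed.

(** Each pair (i, y) contributes at most 1 / k: entries are at most 1, hence bounded in square by
    themselves, and their sum over x is k times [null_msg]. *)
Lemma score_trace : \sum_x dot (row x score) (row x score) <= (n * #|Y|)%:R / k%:R.
Proof.
have kR := kR_gt0.
pose G x (z : 'I_n * Y) := V z.1 x z.2 ^+ 2 / (k%:R ^+ 2 * null_msg z.1 z.2).
have E x : dot (row x score) (row x score) = \sum_i \sum_y G x (i, y).
  rewrite /dot; transitivity (\sum_(c < #|{: 'I_n * Y}|) G x (enum_val c)).
    apply: eq_bigr => c _; rewrite !mxE /G mulrACA -invfM -!expr2 exprMn sqr_sqrtr//.
    exact: null_msg_ge0.
  rewrite -(big_enum_val (G x)) pair_bigA /=.
  by apply: eq_big => -[].
under eq_bigr do rewrite E.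
rewrite exchange_big /=; under eq_bigr do rewrite exchange_big /=.
have -> : (n * #|Y|)%:R / k%:R = \sum_(i < n) \sum_(y : Y) k%:R^-1 :> R.
  by rewrite !sumr_const card_ord -mulrnA mulnC -[RHS]mulr_natr mulrC.
apply: ler_sum => i _; apply: ler_sum => y _; rewrite /G /=.
have [P0|Pn] := eqVneq (null_msg i y) 0.
  by rewrite big1 ?invr_ge0 ?ltW// => x _; rewrite P0 mulr0 invr0 mulr0.
have Pp : 0 < null_msg i y by rewrite lt0r Pn null_msg_ge0.
rewrite -mulr_suml ler_pdivrMr ?mulr_gt0 ?exprn_gt0//.
have -> : k%:R^-1 * (k%:R ^+ 2 * null_msg i y) = \sum_x V i x y.
  by rewrite /null_msg -mulr_sumr; field; rewrite gt_eqF.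
apply: ler_sum => x _; rewrite expr2 ler_piMr//.
rewrite -(V1 i x) (bigD1 y)//= lerDl; exact: sumr_ge0.
Qed.

(** The right side dominates the sum of M^2 / P, one plus the chi-square divergence of the mixture M
    from the null law P. These laws differ by more than 10/12 on B, which forces the value 61/36 = 1
    + (10/12)^2. *)
Lemma chi2_lower_bound (mu : seq (R * 'rV[R]_k)) (B : pred {ffun 'I_n -> Y}) :
  is_law (fun f => [/\ forall x, -1 <= f 0 x, \sum_x f 0 x = 0 &
                       message_prob V (perturbed f) B < 1 / 12]) mu ->
  11 / 12 < message_prob V (fun=> k%:R^-1) B ->
  61 / 36 < expect mu (fun f => expect mu (fun f' =>
    expR (dot (f *m score) (f' *m score)))).
Proof.
move=> muP null_acc.
pose Q f i y := null_msg i y + shift_msg f i y.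
have QE f i y : Q f i y = \sum_x perturbed f x * V i x y by rewrite perturbed_msg.
have Q0 f i y : null_msg i y = 0 -> Q f i y = 0.
  by move=> P0; rewrite /Q P0 shift_msg0// addr0.
have Qge0 f i y : (forall x, -1 <= f 0 x) -> 0 <= Q f i y.
  move=> f1; rewrite QE; apply: sumr_ge0 => x _; rewrite mulr_ge0// divr_ge0//.
  by have := f1 x; lra.
have Qsum f i : \sum_x f 0 x = 0 -> \sum_y Q f i y = 1.
  by move=> f0; rewrite big_split /= null_msg_sum shift_msg_sum// addr0.
pose P (y : {ffun 'I_n -> Y}) := \prod_i null_msg i (y i).
pose Qn f (y : {ffun 'I_n -> Y}) := \prod_i Q f i (y i).
pose M y := expect mu (fun f => Qn f y).
have P_ge0 y : 0 <= P y by apply: prodr_ge0 => i _; exact: null_msg_ge0.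
have Psum : \sum_y P y = 1.
  by rewrite /P -(bigA_distr_bigA null_msg) big1// => i _; exact: null_msg_sum.
have Qnsum f : \sum_x f 0 x = 0 -> \sum_y Qn f y = 1.
  by move=> f0; rewrite /Qn -(bigA_distr_bigA (Q f)) big1// => i _; exact: Qsum.
have Qn0 f y : P y = 0 -> Qn f y = 0.
  move/eqP; rewrite prodf_seq_eq0 => /hasP[i _ /= /eqP Pi].
  by rewrite /Qn (bigD1 i)//= Q0// mul0r.
have M0 y : P y = 0 -> M y = 0.
  by move=> Py; rewrite /M /expect big1// => a _; rewrite Qn0// mulr0.
have Msum : \sum_y M y = 1.
  rewrite /M -expect_sum -[RHS](expect_cst 1 muP) /expect big_seq [RHS]big_seq.
  apply: eq_bigr => a /muP.1[_ [_ a0 _]]; by rewrite Qnsum.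
have MB : \sum_(y | B y) M y <= 1 / 12.
  rewrite /M -expect_sum -[leRHS](expect_cst (1 / 12) muP).
  apply: (expect_le muP) => f [_ _ /ltW]; congr (_ <= _).
  by apply: eq_bigr => y _; apply: eq_bigr => i _; rewrite QE.
have PB1 : \sum_(y | B y) P y <= 1.
  rewrite -Psum [leLHS]big_mkcond; apply: ler_sum => y _; by case: ifP.
have PB : 11 / 12 < \sum_(y | B y) P y by [].
(* Tangent-line form of Cauchy-Schwarz for (P - M)^2 / P, used with s = 10/12 on B and s = 0 off it.
   Where P vanishes so does M, and division by zero gives 0. *)
have point y s : 2 * s * (P y - M y) - s ^+ 2 * P y <= P y - 2 * M y + M y ^+ 2 / P y.
  have [Py|Pn] := eqVneq (P y) 0.
    by rewrite Py M0// subrr !mulr0 expr0n /= mul0r subrr addr0.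
  have Pp : 0 < P y by rewrite lt0r Pn P_ge0.
  have -> : P y - 2 * M y + M y ^+ 2 / P y = (P y - M y) ^+ 2 / P y by field.
  rewrite ler_pdivlMr//; have := sqr_ge0 (P y - M y - s * P y); lra.
have lower : 61 / 36 < \sum_y M y ^+ 2 / P y.
  have h : \sum_(y | B y) (2 * (10 / 12) * (P y - M y) - (10 / 12) ^+ 2 * P y) <=
      \sum_y (P y - 2 * M y + M y ^+ 2 / P y).
    rewrite big_mkcond; apply: ler_sum => y _; case: ifP => _; first exact: point.
    by have := point y 0; rewrite mulr0 mul0r expr0n /= mul0r subr0.
  move: h; rewrite sumrB -!mulr_sumr sumrB big_split /= sumrB -mulr_sumr Psum Msum.
  move: PB PB1 MB; lra.
apply: (lt_le_trans lower).
have ME y : M y ^+ 2 / P y = expect mu (fun f => expect mu (fun f' => Qn f y * Qn f' y / P y)).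
  rewrite expr2 -mulrA mulrC {2}/M -expectZ; apply: eq_expect => f.
  by rewrite mulrC mulrA /M -expectZ mulrC -expectZ; apply: eq_expect => f'; ring.
under eq_bigr do rewrite ME.
rewrite -expect_sum; apply: (expect_le muP) => f [f1 f0 _].
rewrite -expect_sum; apply: (expect_le muP) => f' [f1' f0' _].
pose G i y := Q f i y * Q f' i y / null_msg i y.
have -> : \sum_y Qn f y * Qn f' y / P y = \prod_i \sum_y G i y.
  rewrite bigA_distr_bigA; apply: eq_bigr => y _ /=.
  by rewrite /G big_split big_split /= prodfV.
(* Shifts have total mass zero, so player i contributes exactly 1 plus the inner product of the two
   shifts, at most its exponential. *)
rewrite dot_score expR_sum; apply: ler_prod => i _; apply/andP; split.
  by apply: sumr_ge0 => y _; rewrite divr_ge0 ?null_msg_ge0// mulr_ge0// Qge0.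
apply: le_trans (expR_ge1Dx _).
rewrite le_eqVlt; apply/orP; left; apply/eqP.
transitivity (\sum_y (null_msg i y + shift_msg f i y + shift_msg f' i y +
    shift_msg f i y * shift_msg f' i y / null_msg i y)).
  apply: eq_bigr => y _; rewrite /G; have [P0|Pn] := eqVneq (null_msg i y) 0.
    by rewrite !Q0// P0 !shift_msg0// !(mul0r, addr0).
  by rewrite /Q; field.
by rewrite !big_split /= null_msg_sum !shift_msg_sum// !addr0.
Qed.

End ChiSquare.

(** * The lower bound *)

Section LowerBound.
Variable R : realType.

(** Moves the k score vectors into dimension k, so that the Gaussian comparison costs k factors and
    not n |Y|. This is an inductive Cholesky factorization: the first row gets the coordinates of
    its projection on the others and one new coordinate for its distance to their span. *)
Lemma gram_square k m (W : 'M[R]_(k, m)) :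
  exists M : 'M[R]_k, W *m W^T = M *m M^T.
Proof.
elim: k W => [|k IH]; first by exists 0; apply/matrixP => -[].
rewrite -[k.+1]/(1 + k)%N => W; rewrite -[W]vsubmxK; set w := usubmx _; set W0 := dsubmx _.
have [M0 M0E] := IH W0.
have /submxP[u uE] : (w *m rowproj W0 <= W0)%MS.
  exact: submx_trans (submxMl _ _) (rowproj_sub _).
have uW : u *m W0 *m W0^T = w *m W0^T.
  rewrite -uE -mulmxA; congr (_ *m _).
  by apply: trmx_inj; rewrite trmx_mul rowproj_tr trmxK rowproj_id.
pose c := Num.sqrt (dot w w - projsq W0 w).
have c2 : c * c = dot w w - projsq W0 w.
  by rewrite -expr2 sqr_sqrtr// subr_ge0 projsq_le.
have ur : u *m M0 *m M0^T = w *m W0^T by rewrite -mulmxA -M0E mulmxA.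
have dl : M0 *m (u *m M0)^T = W0 *m w^T.
  by apply: trmx_inj; rewrite [LHS]trmx_mul [RHS]trmx_mul !trmxK.
have ul : u *m M0 *m (u *m M0)^T = (projsq W0 w)%:M.
  rewrite trmx_mul mulmxA ur [LHS]mx11_scalar; congr (_%:M).
  by rewrite -mulmxA -trmx_mul -uE -dotE -projsqE.
exists (block_mx c%:M (u *m M0) 0 M0 : 'M[R]_(1 + k)).
rewrite tr_col_mx mul_col_row tr_block_mx mulmx_block.
rewrite tr_scalar_mx trmx0 !mul0mx mulmx0 !add0r -M0E ur dl ul.
congr block_mx; rewrite -scalar_mxM c2 -raddfD /= subrK.
by rewrite [LHS]mx11_scalar dotE.
Qed.

Lemma dot_gram k m m' (W : 'M[R]_(k, m)) (M : 'M[R]_(k, m')) (f g : 'rV_k) :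
  W *m W^T = M *m M^T -> dot (f *m W) (g *m W) = dot (f *m M) (g *m M).
Proof.
by move=> WM; rewrite !dotE !trmx_mul !mulmxA -(mulmxA f) WM mulmxA.
Qed.

Lemma bernoulli (u : R) k : 0 <= u -> u <= 1 -> 1 - k%:R * u <= (1 - u) ^+ k.
Proof.
move=> u0 u1; elim: k => [|k IH]; first by rewrite mul0r subr0 expr0.
have h : 0 <= 1 - u by lra.
rewrite exprS; apply: le_trans (ler_wpM2l h IH); rewrite -natr1.
have : 0 <= k%:R * u ^+ 2 by rewrite mulr_ge0 ?sqr_ge0.
lra.
Qed.

Lemma sqrt_pow_bound k (u : R) : 0 <= u -> u <= 1 / 2 -> k%:R * u <= 1 / 4 ->
  (Num.sqrt (1 - u))^-1 ^+ k <= 4 / 3.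
Proof.
move=> u0 u1 ku; have h : 0 < 1 - u by lra.
have s0 : 0 < Num.sqrt (1 - u) by rewrite sqrtr_gt0.
have le_s : 1 - u <= Num.sqrt (1 - u).
  have s1 : Num.sqrt (1 - u) <= 1 by rewrite -[leRHS]sqrtr1 ler_sqrt; lra.
  have := @sqr_sqrtr _ (1 - u) (ltW h); rewrite expr2 => {1}<-.
  by rewrite ler_piMr// ltW.
have u1' : u <= 1 by lra.
have : 3 / 4 <= Num.sqrt (1 - u) ^+ k.
  apply: le_trans (_ : (1 - u) ^+ k <= _); last by rewrite lerXn2r// nnegrE ltW.
  by apply: le_trans (bernoulli k u0 u1'); lra.
rewrite exprVn => h34; have -> : 4 / 3 = (3 / 4)^-1 :> R by rewrite invf_div.
by rewrite lef_pV2 ?posrE ?exprn_gt0//; lra.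
Qed.

Variables (k : nat) (Y : finType) (n : nat) (V : 'I_n -> 'I_k -> Y -> R).
Hypothesis k_gt1 : (1 < k)%N.
Hypothesis n_gt0 : (0 < n)%N.
Hypothesis Y_gt0 : (0 < #|Y|)%N.
Hypothesis V0 : forall i x y, 0 <= V i x y.
Hypothesis V1 : forall i x, \sum_y V i x y = 1.

Let k_gt0 : (0 < k)%N := ltnW k_gt1.
Let kR : 0 < k%:R :> R. Proof. by rewrite ltr0n. Qed.

(** The bound on the mean squared score norm, divided by [eta]; by Markov's inequality at most a
    fraction [eta] of the elements exceeds it. *)
Definition light_bound (eta : R) : R := (n * #|Y|)%:R / (eta * k%:R ^+ 2).

Lemma card_light eta : 0 < eta ->
  (1 - eta) * k%:R <= #|[set x | dot (row x (score V)) (row x (score V)) <= light_bound eta]|%:R.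
Proof.
move=> eta0; set S := [set x | _].
have NY : 0 < (n * #|Y|)%:R :> R by rewrite ltr0n muln_gt0 n_gt0.
have Hm0 : 0 < light_bound eta by rewrite divr_gt0// mulr_gt0// exprn_gt0.
have bad : #|~: S|%:R * light_bound eta <= (n * #|Y|)%:R / k%:R.
  apply: le_trans (score_trace k_gt0 V0 V1).
  rewrite mulr_natl -sumr_const [leRHS](bigID (mem (~: S)))/=.
  rewrite -[leLHS]addr0; apply: lerD; last first.
    by apply: sumr_ge0 => x _; exact: dot_ge0.
  by apply: ler_sum => x; rewrite !inE -ltNge => /ltW.
have badk : #|~: S|%:R <= eta * k%:R.
  rewrite -(ler_pM2r Hm0); apply: le_trans bad _; rewrite le_eqVlt; apply/orP; left.
  by apply/eqP; rewrite /light_bound; field; rewrite !gt_eqF.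
have : #|S|%:R + #|~: S|%:R = k%:R :> R by rewrite -natrD cardsC card_ord.
lra.
Qed.

Variables (B : pred {ffun 'I_n -> Y}) (eps eta lam : R) (r : nat).
Hypothesis eta_gt0 : 0 < eta.
Hypothesis lam_ge0 : 0 <= lam.
Hypothesis lam_le1 : lam <= 1.
Hypothesis far_zeros : forall s, (1 - eta) * k%:R <= s%:R -> (s <= k)%N ->
  eps * k%:R < lam * (halving_zeros r s)%:R.
Hypothesis accept : 11 / 12 < message_prob V (uniform R k_gt0) B.
Hypothesis reject : forall p : dist R 'I_k, eps < dTV p (uniform R k_gt0) ->
  message_prob V p B < 1 / 12.

Let f0 : 'rV[R]_k := const_mx 1.

(** A perturbation of sum zero has total variation equal to the mass of its negative part, to which
    every zero of [f] in [S] contributes lam / k. *)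
Lemma perturbed_rejected (S : {set 'I_k}) f : (1 - eta) * k%:R <= #|S|%:R ->
  halving_outcome r S f0 f ->
  [/\ forall x, -1 <= (lam *: (f - f0)) 0 x, \sum_x (lam *: (f - f0)) 0 x = 0 &
      message_prob V (perturbed (lam *: (f - f0))) B < 1 / 12].
Proof.
move=> cardS [off fge0 fsum fzero].
have fE x : (lam *: (f - f0)) 0 x = lam * (f 0 x - 1) by rewrite !mxE.
have lo x : - lam <= lam * (f 0 x - 1).
  have f00 : 0 <= f 0 x.
    by have [/fge0//|/off ->] := boolP (x \in S); rewrite mxE.
  by have := mulr_ge0 lam_ge0 f00; lra.
have ge x : -1 <= (lam *: (f - f0)) 0 x by rewrite fE; apply: le_trans (lo x); rewrite lerN2.
have sum0 : \sum_x (lam *: (f - f0)) 0 x = 0.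
  under eq_bigr do rewrite fE.
  rewrite -mulr_sumr sumrB fsum; under eq_bigr do rewrite mxE.
  by rewrite subrr mulr0.
split=> //.
have p0 x : 0 <= perturbed (lam *: (f - f0)) x.
  by rewrite divr_ge0//; have := ge x; lra.
have p1 : \sum_x perturbed (lam *: (f - f0)) x = 1.
  rewrite -mulr_suml big_split /= sum0 addr0 sumr_const card_ord.
  by rewrite divff// gt_eqF.
apply: (reject (p := Dist p0 p1)).
have -> : dTV (Dist p0 p1) (uniform R k_gt0) =
    (2 * k%:R)^-1 * \sum_x `|(lam *: (f - f0)) 0 x|.
  rewrite /dTV invfM -mulrA; congr (_ * _); rewrite mulr_sumr; apply: eq_bigr => x _ /=.
  rewrite /perturbed mulrDl mul1r addrAC subrr add0r normrM mulrC.
  by rewrite [`|k%:R^-1|]ger0_norm ?invr_ge0.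
have zeros : 2 * lam * #|[set x in S | (f 0 x == 0)%R]|%:R <=
    \sum_x `|(lam *: (f - f0)) 0 x|.
  have -> : \sum_x `|(lam *: (f - f0)) 0 x| =
      \sum_x (`|(lam *: (f - f0)) 0 x| - (lam *: (f - f0)) 0 x).
    by rewrite sumrB sum0 subr0.
  rewrite mulr_natr -sumr_const.
  rewrite [leRHS](bigID (mem [set x in S | (f 0 x == 0)%R]))/= -[leLHS]addr0.
  apply: lerD; last by apply: sumr_ge0 => x _; rewrite subr_ge0 ler_norm.
  apply: ler_sum => x; rewrite inE => /andP[_ /eqP fx].
  by rewrite fE fx sub0r mulrN1 normrN ger0_norm//; lra.
rewrite mulrC ltr_pdivlMr ?mulr_gt0//; apply: lt_le_trans zeros.
have sk : (#|S| <= k)%N by rewrite -[leqRHS]card_ord max_card.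
have := far_zeros cardS sk.
have : lam * (halving_zeros r #|S|)%:R <= lam * #|[set x in S | (f 0 x == 0)%R]|%:R.
  by rewrite ler_wpM2l// ler_nat.
lra.
Qed.

(** If it failed, (1 - v^2)^(-k/2) would be at most 4/3, contradicting the lower bound 61/36. Here v
    / 2 is the coefficient given by [random_halving] after scaling by [lam]. *)
Lemma sample_bound :
  1 / 4 < k%:R * (8 * (lam ^+ 2 * (4 ^+ r.+1 - 4) * light_bound eta)) ^+ 2.
Proof.
rewrite ltNge; apply/negP => kv; set v := 8 * _ in kv.
have Hm0 : 0 <= light_bound eta by rewrite divr_ge0// mulr_ge0 ?sqr_ge0// ltW.
have r4 : 0 <= 4 ^+ r.+1 - 4 :> R.
  have : 1 <= 4 ^+ r :> R by rewrite exprn_ege1// ler1n.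
  by rewrite exprS; lra.
have v0 : 0 <= v.
  by rewrite /v mulr_ge0// mulr_ge0// mulr_ge0// exprn_ge0.
have v2 : v ^+ 2 <= 1 / 8.
  have k2 : 2 <= k%:R :> R by rewrite ler_nat.
  have : 2 * v ^+ 2 <= k%:R * v ^+ 2 by rewrite ler_wpM2r ?sqr_ge0.
  lra.
have [M ME] := gram_square (score V).
set S := [set x | dot (row x (score V)) (row x (score V)) <= light_bound eta].
have hS x : x \in S -> dot (row x M) (row x M) <= light_bound eta.
  by rewrite inE => xS; rewrite !rowE -(dot_gram _ _ ME) -!rowE.
have f0S x : x \in S -> f0 0 x = 1 by rewrite mxE.
have [mu muP mub] := random_halving r ler01 Hm0 f0S hS.
pose nu := law_bind mu (fun f => [:: (1, lam *: (f - f0))]).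
have cardS := card_light eta_gt0.
have nuP : is_law (fun f : 'rV[R]_k => [/\ forall x, -1 <= f 0 x, \sum_x f 0 x = 0 &
                       message_prob V (perturbed f) B < 1 / 12]) nu.
  apply: (is_law_bind muP) => f fP; apply: is_law_pt.
  exact: perturbed_rejected fP.
have sub t : expect nu (fun f => expR (dot (f *m M) t)) <= expR (v / 2 * dot t t).
  rewrite expect_bind.
  have -> : v / 2 * dot t t =
      4 * (1 ^+ 2 * (4 ^+ r.+1 - 4) * light_bound eta) * dot (lam *: t) (lam *: t).
    by rewrite dotZl dotZr /v expr1n; field.
  apply: le_trans (mub _); rewrite le_eqVlt; apply/orP; left; apply/eqP.
  apply: eq_expect => f; rewrite expect_pt -scalemxAl dotZl dotZr; congr expR.
have := chi2_lower_bound k_gt0 V0 V1 nuP accept; apply/negP; rewrite -leNgt.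
(* The score of one copy serves as the direction t in the subgaussian bound for the other. *)
apply: (@le_trans _ _ (expect nu (fun f => expR (v / 2 * dot (f *m M) (f *m M))))).
  apply: (expect_le nuP) => f _; apply: le_trans (sub (f *m M)).
  rewrite le_eqVlt; apply/orP; left; apply/eqP; apply: eq_expect => f'.
  by rewrite dotC (dot_gram _ _ ME).
have v21 : v ^+ 2 < 1 by lra.
apply: le_trans (subgaussian_square nuP v0 v21 sub) _.
have v2h : v ^+ 2 <= 1 / 2 by lra.
apply: le_trans (sqrt_pow_bound (sqr_ge0 v) v2h kv) _; lra.
Qed.

End LowerBound.

Section Reduction.
Variables (R : realType) (k : nat) (Y : finType) (n : nat).
Variable V : 'I_n -> 'I_k -> Y -> R.
Hypothesis V1 : forall i x, \sum_y V i x y = 1.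

Lemma message_probC (p : dist R 'I_k) (B C : pred {ffun 'I_n -> Y}) :
  C =1 predC B -> message_prob V p B + message_prob V p C = 1.
Proof.
move=> BC; pose G i y := \sum_x p x * V i x y.
transitivity (\sum_(y : {ffun 'I_n -> Y}) \prod_i G i (y i)).
  by rewrite [RHS](bigID B) /=; congr (_ + _); exact: eq_bigl.
rewrite -(bigA_distr_bigA G) big1// => i _.
rewrite exchange_big /= -[RHS](pmf_sum1 p); apply: eq_bigr => x _.
by rewrite -mulr_sumr V1 mulr1.
Qed.

End Reduction.

(** * Choice of the constants and final assembly *)

Section Numerics.
Variable R : realType.

Lemma powR32_sqr (k : nat) : ((k%:R : R) `^ (3 / 2)) ^+ 2 = k%:R ^+ 3.
Proof.
rewrite -powR_mulrn ?powR_ge0// -powRrM.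
by rewrite (_ : 3 / 2 * 2%:R = 3%:R) ?powR_mulrn//; field.
Qed.

(** Of the gap 1 - eps1, an eighth goes to the heavy elements, an eighth to the final survivors and
    less than a half to rounding; a quarter is left over. *)
Lemma halving_zeros_large (eps1 eta : R) (r K0 k s : nat) : eps1 < 1 ->
  eta = (1 - eps1) / 8 -> (2 ^+ r)^-1 <= eta ->
  r%:R < K0%:R * ((1 - eps1) / 2) -> (K0 <= k)%N ->
  (1 - eta) * k%:R <= s%:R -> (s <= k)%N ->
  eps1 * k%:R < (halving_zeros r s)%:R.
Proof.
move=> e1 etaE r2 rK Kk s1 s2; apply: lt_le_trans (halving_zeros_lb R r s).
have s2' : s%:R <= k%:R :> R by rewrite ler_nat.
have Kk' : K0%:R <= k%:R :> R by rewrite ler_nat.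
have k0 : 0 <= k%:R :> R by [].
have h1 : s%:R / 2 ^+ r <= k%:R * eta.
  by apply: ler_pM => //; rewrite invr_ge0 exprn_ge0.
have h2 : r%:R < k%:R * ((1 - eps1) / 2).
  by apply: (lt_le_trans rK); rewrite ler_wpM2r// divr_ge0// subr_ge0 ltW.
have : 0 <= k%:R * (1 - eps1) by rewrite mulr_ge0// subr_ge0 ltW.
by move: s1; rewrite etaE in h1 *; lra.
Qed.

Lemma exists_halving_depth (eta : R) : 0 < eta ->
  exists2 r : nat, (0 < r)%N & (2 ^+ r)^-1 <= eta.
Proof.
move=> eta0; set m := Num.trunc eta^-1; exists m.+1 => //.
rewrite -[leRHS]invrK lef_pV2 ?posrE ?exprn_gt0 ?invr_gt0//.
apply: (@le_trans _ _ m.+1%:R).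
  by rewrite ltW// ltNge -truncn_gt_nat ltnn.
by rewrite -natrX ler_nat ltnW// ltn_expl.
Qed.

Lemma sample_size_lb (k : nat) (lam L C x N : R) : 0 < k%:R :> R -> 0 <= C ->
  0 <= N -> 0 <= L -> 0 <= x -> x ^+ 2 = k%:R ^+ 3 ->
  1 / 4 < k%:R * (lam ^+ 2 * C * (N * L / k%:R ^+ 2)) ^+ 2 ->
  x <= 2 * lam ^+ 2 * C * N * L.
Proof.
move=> k0 C0 N0 L0 x0 xE h.
have y0 : 0 <= 2 * lam ^+ 2 * C * N * L.
  by do 3![apply: mulr_ge0 => //]; rewrite mulr_ge0// sqr_ge0.
rewrite -(@ler_pXn2r _ 2)//.
have k3 : 0 < k%:R ^+ 3 :> R by rewrite exprn_gt0.
move: h; rewrite -(ltr_pM2l k3).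
rewrite (_ : k%:R ^+ 3 * (k%:R * _) = (lam ^+ 2 * C * N * L) ^+ 2); last first.
  by field; rewrite gt_eqF.
by rewrite xE; lra.
Qed.

End Numerics.

Unset Implicit Arguments.

(* The constant c is uniform in k, l and eps, for eps bounded away from 1;
   no constant is uniform up to eps = 1, since for eps >= 1 - 1/k no
   distribution is eps-far from uniform and one player suffices. *)
Theorem theorem5p4 (R : realType) (eps0 : R) (heps0 : eps0 < 1) :
  exists2 c : R, 0 < c &
    forall (k l : nat) (eps : R) (hk : (2 <= k)%N),
      ~~ odd k -> (1 <= l)%N -> 0 < eps -> eps <= eps0 ->
      ((c * (k%:R `^ (3 / 2) / (2 ^+ l * eps ^+ 2)))%:E <=
        private_sample_complexity (bit_channels R k l)
          (uniform R (ltnW hk)) eps)%E.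
Proof.
(* The floor 1/2 keeps the amplitude eps / eps1 below 2 eps; it also makes eta at most 1/16. *)
pose eps1 := Num.max eps0 (1 / 2).
have e1 : eps1 < 1 by rewrite gt_max heps0; lra.
have e1h : 1 / 2 <= eps1 by rewrite le_max lexx orbT.
pose eta := (1 - eps1) / 8.
have eta0 : 0 < eta by rewrite /eta; lra.
have [r r0 r2] := exists_halving_depth eta0.
pose K0 := (Num.trunc (r%:R / ((1 - eps1) / 2))).+1.
have rK : r%:R < K0%:R * ((1 - eps1) / 2).
  by rewrite -ltr_pdivrMr; [rewrite ltNge -truncn_gt_nat ltnn|lra].
have K1 : 1 <= K0%:R :> R by rewrite ler1n.
pose C := 8 * (4 ^+ r.+1 - 4) / eta.
have C0 : 0 <= C.
  have : 1 <= 4 ^+ r :> R by rewrite exprn_ege1// ler1n.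
  by move=> h; rewrite /C divr_ge0// ?(ltW eta0)// mulr_ge0// exprS; lra.
(* Dominates both amplitudes used below, 2 eps for large k and K0 eps for small k. In [D] the first
   term serves these constructions and K0^4 the remaining bounded range. *)
pose Lam : R := K0%:R + 2.
pose D := 2 * Lam ^+ 2 * C + K0%:R ^+ 4.
have D0 : 0 < D.
  by rewrite ltr_wpDl ?exprn_gt0 ?(lt_le_trans ltr01)// mulr_ge0// mulr_ge0// sqr_ge0.
exists D^-1; first by rewrite invr_gt0.
move=> k l eps hk _ l1 eps_gt0 eps_le.
apply: le_ereal_inf_tmp => _ [n [n0 [prot [T [acc rej]]]] <-]; rewrite lee_fin.
set x := k%:R `^ (3 / 2).
have x0 : 0 <= x by exact: powR_ge0.
have x2 : x ^+ 2 = k%:R ^+ 3 by exact: powR32_sqr.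
have L1 : 1 <= 2 ^+ l :> R by rewrite exprn_ege1// ler1n.
have L0 : 0 < 2 ^+ l :> R by rewrite exprn_gt0.
have E0 : 0 < eps ^+ 2 by rewrite exprn_gt0.
have N1 : 1 <= n%:R :> R by rewrite ler1n.
have kR : 0 < k%:R :> R by rewrite ltr0n ltnW.
suff : x <= D * n%:R * (2 ^+ l * eps ^+ 2).
  by rewrite ler_pdivrMl// ler_pdivrMr// mulr_gt0.
have eps_le1 : eps <= eps1 by rewrite le_max eps_le.
have main lam : 0 <= lam -> lam <= 1 -> lam <= Lam * eps ->
    (forall s, (1 - eta) * k%:R <= s%:R -> (s <= k)%N ->
      eps * k%:R < lam * (halving_zeros r s)%:R) ->
    x <= D * n%:R * (2 ^+ l * eps ^+ 2).
  move=> lam0 lam1 lamE far.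
  have [V [V0 V1 VE]] := decision_probE prot.
  pose B : pred {ffun 'I_n -> l.-tuple bool} := [pred y | T y == true].
  have accB : 11 / 12 < message_prob V (uniform R (ltnW hk)) B.
    by move: acc; rewrite VE lte_fin.
  have rejB (p : dist R 'I_k) : eps < dTV p (uniform R (ltnW hk)) ->
      message_prob V p B < 1 / 12.
    move=> /rej; rewrite VE lte_fin.
    have BC : [pred y | T y == false] =1 predC B by move=> y; rewrite /B /=; case: (T y).
    by have := message_probC V1 p BC; lra.
  have Y0 : (0 < #|{: l.-tuple bool}|)%N by rewrite card_tuple card_bool expn_gt0.
  have := sample_bound n0 Y0 V0 V1 eta0 lam0 lam1 far accB rejB.
  rewrite /light_bound card_tuple card_bool natrM natrX => h.
  have h' : x <= 2 * lam ^+ 2 * C * n%:R * 2 ^+ l.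
    apply: (@sample_size_lb _ k) => //.
    rewrite (_ : lam ^+ 2 * C * _ =
      8 * (lam ^+ 2 * (4 ^+ r.+1 - 4) * (n%:R * 2 ^+ l / (eta * k%:R ^+ 2))))//.
    by rewrite /C; field; rewrite !gt_eqF.
  apply: (le_trans h').
  have lam2 : lam ^+ 2 <= Lam ^+ 2 * eps ^+ 2.
    by rewrite -exprMn lerXn2r// nnegrE// (le_trans lam0).
  have NL : 0 <= n%:R * 2 ^+ l :> R by rewrite mulr_ge0// ltW.
  have : 2 * lam ^+ 2 * C * (n%:R * 2 ^+ l) <=
         2 * (Lam ^+ 2 * eps ^+ 2) * C * (n%:R * 2 ^+ l).
    by rewrite ler_wpM2r// ler_wpM2r// ler_wpM2l.
  have : 0 <= K0%:R ^+ 4 * (n%:R * 2 ^+ l) * eps ^+ 2.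
    by rewrite mulr_ge0 ?(ltW E0)// mulr_ge0// exprn_ge0.
  rewrite /D; lra.
have [Kk|kK] := leqP K0 k.
  apply: (main (eps / eps1)).
  - by rewrite divr_ge0; lra.
  - by rewrite ler_pdivrMr ?mul1r//; lra.
  - rewrite mulrC ler_wpM2r ?(ltW eps_gt0)//.
    apply: (@le_trans _ _ 2); last by rewrite lerDr.
    by rewrite -[leRHS]invrK lef_pV2 ?posrE; lra.
  move=> s s1 s2; have := halving_zeros_large e1 erefl r2 rK Kk s1 s2.
  have ep : 0 < eps / eps1 by rewrite divr_gt0//; lra.
  rewrite -(ltr_pM2l ep) mulrA divfK//; lra.
(* For k < K0 a single zero of amplitude K0 eps is already far enough, since eps k < K0 eps; this is
   a legal amplitude as long as it is at most 1. *)
have [Ke|eK] := leP (K0%:R * eps) 1.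
  apply: (main (K0%:R * eps)) => //.
  - by rewrite mulr_ge0// ltW.
  - by rewrite ler_wpM2r ?(ltW eps_gt0)// lerDl.
  move=> s s1 s2.
  have s3 : (2 <= s)%N.
    rewrite -(ltr_nat R); apply: lt_le_trans s1.
    have k2 : 2 <= k%:R :> R by rewrite ler_nat.
    have : eta <= 1 / 16 by rewrite /eta; lra.
    nra.
  have Z1 : 1 <= (halving_zeros r s)%:R :> R by rewrite ler1n halving_zeros_ge1.
  apply: (@lt_le_trans _ _ (K0%:R * eps)).
    by rewrite mulrC ltr_pM2r// ltr_nat.
  by rewrite ler_peMr// mulr_ge0// ltW.
(* Both k and 1 / eps are now at most K0, so the bound holds for every n >= 1 thanks to K0^4 in
   [D]. *)
have xK : x <= K0%:R ^+ 2.
  rewrite -(@ler_pXn2r _ 2)// ?nnegrE ?exprn_ge0// x2 -exprM.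
  have kK' : k%:R <= K0%:R :> R by rewrite ler_nat ltnW.
  apply: (@le_trans _ _ (K0%:R ^+ 3)); first by rewrite lerXn2r// nnegrE ltW.
  by rewrite [leRHS]exprS ler_peMl// exprn_ge0.
have eK2 : 1 <= K0%:R ^+ 2 * eps ^+ 2.
  by rewrite -exprMn exprn_ege1// ltW.
apply: (@le_trans _ _ (K0%:R ^+ 4 * eps ^+ 2)).
  rewrite (_ : K0%:R ^+ 4 = K0%:R ^+ 2 * K0%:R ^+ 2); last by rewrite -exprD.
  rewrite -mulrA; apply: (le_trans xK); rewrite ler_peMr// sqr_ge0.
have NL : 1 <= n%:R * 2 ^+ l :> R by rewrite mulr_ege1.
have h1 : K0%:R ^+ 4 <= D.
  by rewrite lerDr mulr_ge0// mulr_ge0// sqr_ge0.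
rewrite (_ : D * n%:R * (2 ^+ l * eps ^+ 2) = D * (n%:R * 2 ^+ l) * eps ^+ 2); last by ring.
rewrite ler_wpM2r ?(ltW E0)//; apply: (le_trans h1).
by rewrite ler_peMr// ltW.
Qed.
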